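(* Let $G$ be a non-trivial countable directed graph. Then $\mathfrak L_G$ has a faithful irreducible representation if and only if $G$ is strongly transitive.
   Context: A countable directed graph $G=(\mathcal V(G),\mathcal E(G),r,s)$ consists of a countable set $\mathcal V(G)$ of vertices, a countable set $\mathcal E(G)$ of edges, and range and source maps $r,s:\mathcal E(G)\to\mathcal V(G)$. A path is a finite sequence of edges $p=e_k\cdots e_2e_1$ with $r(e_i)=s(e_{i+1})$ for $1\le i<k$; $s(p)=s(e_1)$, $r(p)=r(e_k)$. Each vertex $x$ is a path of length $0$ with $s(x)=r(x)=x$. $\mathbb F^+(G)$ is the set of all paths (including vertices); the product $pq$ is defined when $r(q)=s(p)$. Let $\mathcal H_G=\ell^2(\mathbb F^+(G))$ with orthonormal basis $\{\xi_w:w\in\mathbb F^+(G)\}$. For $p\in\mathbb F^+(G)$ let $L_p\xi_w=\xi_{pw}$ if $s(p)=r(w)$ and $L_p\xi_w=0$ otherwise. The free semigroupoid algebra $\mathfrak L_G$ is the algebra generated by $\{L_p:p\in\mathbb F^+(G)\}$, closed in the weak operator topology (WOT). A representation of $\mathfrak L_G$ is a norm-continuous algebra homomorphism $\rho:\mathfrak L_G\to\mathcal B(\mathcal H)$, $\mathcal H$ a Hilbert space; it is faithful if injective, and irreducible if $\rho(\mathfrak L_G)$ is WOT-dense in $\mathcal B(\mathcal H)$ (i.e. it is a nest representation for the trivial nest $\{\{0\},\mathcal H\}$). $G$ is transitive if there is a path from each vertex to every other vertex. A cycle graph is a graph with finitely many vertices $x_1,\dots,x_n$ ($n\ge1$)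 and exactly $n$ edges $e_1,\dots,e_n$ with $s(e_i)=x_i$ and $r(e_i)=x_{i+1 \,(\mathrm{mod}\ n)}$. The trivial graph consists of one vertex and no edges. A non-trivial transitive graph which is not a cycle graph is called strongly transitive (so a single vertex with exactly one loop edge is not strongly transitive). *)

(* Defs.v *)
From HB Require Import structures.
From mathcomp Require Import all_boot all_order all_algebra finmap.
From mathcomp Require Import all_classical all_reals all_analysis.
From mathcomp Require Import complex sesquilinear summability ring lra.

Set Implicit Arguments.
Unset Strict Implicit.
Unset Printing Implicit Defensive.

Import Order.TTheory GRing.Theory Num.Theory.
Import numFieldNormedType.Exports.

Local Open Scope classical_set_scope.
Local Open Scope complex_scope.
Local Open Scope ring_scope.

(* [R[i]] is only known to the library as a numeric closed field; equip it with
   the normed module structure of a numeric field acting on itself. *)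
HB.instance Definition _ (R : realType) := NormedModule.copy R[i] R[i]^o.

Section ComplexComplete.
Context {R : realType}.
Local Notation C := R[i].
Local Notation re := (@complex.Re R).
Local Notation im := (@complex.Im R).

Lemma ger0_Re (z : C) : 0 <= z -> (re z)%:C = z.
Proof. by case: z => a b; rewrite lecE /= => /andP[/eqP-> _]. Qed.

Lemma normc_Re (z : C) : (re `|z|)%:C = `|z|.
Proof. by rewrite normc_def. Qed.

Let normci : `|'i%C : C| = 1.
Proof. by rewrite normc_def /= expr0n expr1n add0r sqrtr1. Qed.

Lemma ler_normc_ReIm (z : C) :
  `|z| <= (`|re z| + `|im z|)%:C.
Proof.
rewrite [in leLHS](complexE z) (le_trans (ler_normD _ _))// normrM.
rewrite normci mul1r !normc_def /= expr0n /= !addr0 !sqrtr_sqr.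
by rewrite -rmorphD.
Qed.

Let lip_cvg (f : C -> R) (F : set_system C) :
  (forall x y, `|f x - f y|%:C <= `|x - y|) ->
  ProperFilter F -> cauchy F -> cvg (f @ F).
Proof.
move=> fl FF Fc0; have Fc := (cauchyP F (PF := FF)).1 Fc0.
apply: cauchy_cvg; apply: cauchy_exP => e e0.
have e0C : 0 < e%:C by rewrite ltcR.
have [x Fx] := Fc _ e0C; exists (f x).
suff : F (f @^-1` ball (f x) e) by [].
apply: (filterS _ Fx) => y /=; rewrite -!ball_normE /= => xy.
by rewrite -ltcR (le_lt_trans _ xy).
Qed.

Lemma complex_complete (F : set_system C) :
  ProperFilter F -> cauchy F -> cvg F.
Proof.
move=> FF Fc.
have /cvg_ex[a Fa] : cvg (re @ F).
  by apply: lip_cvg Fc => x y; rewrite -raddfB normc_ge_Re.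
have /cvg_ex[b Fb] : cvg (im @ F).
  apply: lip_cvg Fc => x y; rewrite -raddfB.
  have := normc_ge_Re ((x - y) * 'i%C).
  by rewrite normrM normci mulr1 ReiNIm normrN.
apply/cvg_ex; exists (a +i* b); apply/cvgrPdist_lt => e e0.
have ee : e = (re e)%:C by rewrite -[LHS]gtr0_norm// -normc_Re gtr0_norm.
have e20 : 0 < re e / 2 by rewrite divr_gt0// -ltcR -ee.
move/cvgrPdist_lt : Fa => /(_ _ e20) Fa; move/cvgrPdist_lt : Fb => /(_ _ e20) Fb.
near=> z; rewrite (le_lt_trans (ler_normc_ReIm _))// ee ltcR.
rewrite [ltRHS]splitr ltrD// !raddfB /=; first by near: z.
by near: z.
Unshelve. all: by end_near. Qed.

End ComplexComplete.

(* [totally] is the filter of large finite sets, so [sum] is the unconditional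
   sum of a family indexed by a set. *)
#[global] Existing Instance totally_filter.

Section TotalSums.
Context {R : realType} {X : choiceType}.
Local Notation C := R[i].
Implicit Types (u v : X -> C) (A B : {fset X}).

Lemma partial_sumE (V : zmodType) (u : X -> V) A :
  partial_sum u A = \sum_(i <- A) u i.
Proof. by rewrite /partial_sum big_seq_fsetE. Qed.

Lemma cvg_ge0C (T : Type) (F : set_system T) (f : T -> C) (l : C) :
  ProperFilter F -> f @ F --> l -> (\forall x \near F, 0 <= f x) -> 0 <= l.
Proof.
move=> FF /cvgrPdist_lt fl f0; suff /eqP-> : l == `|l| by [].
rewrite -subr_eq0.
apply/negPn/negP => l0; have e0 : 0 < `|l - `|l| | / 2%:R.
  by rewrite divr_gt0 ?normr_gt0// ltr0n.
near F => x.
have lx : `|l - f x| < `|l - `|l| | / 2%:R by near: x; exact: fl.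
have fx0 : 0 <= f x by near: x.
suff : `|l - `|l| | < `|l - `|l| | by rewrite ltxx.
rewrite [ltRHS]splitr (le_lt_trans (ler_distD (f x) _ _))// ltrD//.
rewrite -[X in `|X - _|]ger0_norm// (le_lt_trans (ler_dist_dist _ _))//.
by rewrite distrC.
Unshelve. all: by end_near. Qed.

Lemma partial_sumB u A B : (A `<=` B)%fset ->
  partial_sum u B - partial_sum u A = partial_sum u (B `\` A)%fset.
Proof.
move=> AB; rewrite !partial_sumE; apply/eqP; rewrite subr_eq addrC; apply/eqP.
rewrite (big_fsetID _ (mem A)) /=; congr (_ + _); apply: eq_fbigl => x.
- rewrite !inE /=; case: (boolP (x \in A)) => xA; last by rewrite andbF.
  by rewrite (fsubsetP AB).
- by rewrite !inE /= andbC.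
Qed.

Lemma ler_partial_sum u A B : (forall x, 0 <= u x) -> (A `<=` B)%fset ->
  partial_sum u A <= partial_sum u B.
Proof.
by move=> u0 AB; rewrite -subr_ge0 partial_sumB// partial_sumE sumr_ge0.
Qed.

Lemma partial_sum_cvg u (M : C) :
  (forall A, partial_sum (fun x => `|u x|) A <= M) ->
  cvg (partial_sum u @ totally).
Proof.
move=> uM; apply: complex_complete.
apply: cauchy_exP => e e0.
have re_gt0 (z : C) : 0 < z -> z = (complex.Re z)%:C.
  by move=> z0; rewrite -[LHS]gtr0_norm// -normc_Re gtr0_norm.
pose S := [set complex.Re (partial_sum (fun x => `|u x|) A) | A in [set: {fset X}]].
have reS A : partial_sum (fun x => `|u x|) A =
    (complex.Re (partial_sum (fun x => `|u x|) A))%:C.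
  by rewrite -[LHS]ger0_norm -1?normc_Re ?ger0_norm// partial_sumE sumr_ge0.
have hS : has_sup S.
  split; first by exists (complex.Re (partial_sum (fun x => `|u x|) fset0)), fset0.
  exists (complex.Re M) => _ [A _ <-].
  by have := uM A; rewrite lecE => /andP[].
have e0' : 0 < complex.Re e by rewrite -ltcR -re_gt0.
have [_ [A _ <-] SA] := sup_adherent e0' hS.
exists (partial_sum u A), A => // B /= AB.
rewrite -ball_normE /= distrC partial_sumB// partial_sumE.
apply: le_lt_trans (ler_norm_sum _ _ _) _.
rewrite -partial_sumE -partial_sumB// (reS A) (reS B) -raddfB (re_gt0 e)// ltcR.
rewrite ltrBlDr; apply: (@le_lt_trans _ _ (sup S)).
  by apply: ub_le_sup; [case: hS|exists B].
by rewrite addrC -ltrBlDr.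
Qed.

Lemma sumP u (l : C) : partial_sum u @ totally --> l -> sum u = l.
Proof. by move=> ul; apply: (cvg_lim (@norm_hausdorff _ R[i])). Qed.

Lemma sum_ge u A : (forall x, 0 <= u x) -> cvg (partial_sum u @ totally) ->
  partial_sum u A <= sum u.
Proof.
move=> u0 cu; rewrite -subr_ge0.
apply: (@cvg_ge0C _ totally (fun B => partial_sum u B - partial_sum u A)).
  by apply: cvgB; [exact: cu|exact: cvg_cst].
by exists A => // B /= AB; rewrite subr_ge0 ler_partial_sum.
Qed.

Lemma sum_le u (M : C) : cvg (partial_sum u @ totally) ->
  (forall A, partial_sum u A <= M) -> sum u <= M.
Proof.
move=> cu uM; rewrite -subr_ge0.
apply: (@cvg_ge0C _ totally (fun B => M - partial_sum u B)).
  by apply: cvgB; [exact: cvg_cst|exact: cu].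
by apply: filterE => B; rewrite subr_ge0.
Qed.

Lemma sum_linear (a : C) u v :
  cvg (partial_sum u @ totally) -> cvg (partial_sum v @ totally) ->
  partial_sum (fun x => a * u x + v x) @ totally --> a * sum u + sum v.
Proof.
move=> cu cv; rewrite (_ : partial_sum _ =
    (fun A => a * partial_sum u A + partial_sum v A)); last first.
  apply/funext => A; rewrite !partial_sumE mulr_sumr -big_split.
  by apply: eq_bigr.
by apply: cvgD cv; apply: cvgMr cu.
Qed.

Lemma sum_conj u : cvg (partial_sum u @ totally) ->
  sum (fun x => Num.conj (u x)) = Num.conj (sum u).
Proof.
move=> cu; apply: sumP; rewrite (_ : partial_sum _ =
    (fun A => Num.conj (partial_sum u A))); last first.
  by apply/funext => A; rewrite !partial_sumE rmorph_sum.
apply/cvgrPdist_lt => e e0; have /cvgrPdist_lt/(_ e e0) := cu.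
by apply: filterS => A; rewrite -rmorphB norm_conjC.
Qed.

Lemma sum_eq0 u x : (forall x, 0 <= u x) -> cvg (partial_sum u @ totally) ->
  sum u = 0 -> u x = 0.
Proof.
move=> u0 cu su; apply/eqP; rewrite eq_le u0 andbT -su.
by rewrite (le_trans _ (sum_ge [fset x]%fset u0 cu))// partial_sumE big_seq_fset1.
Qed.

End TotalSums.

Section DotNorm.
Context {C : numClosedFieldType} {U : lmodType C} (f : {dot U for Num.conj}).

Lemma dot_CauchySchwarz (u v : U) : `|f u v| ^+ 2 <= f u u * f v v.
Proof.
have [->|v0] := eqVneq v 0; first by rewrite !linear0r normr0 expr0n.
have fv0 : 0 < f v v by rewrite dnorm_gt0.
have fvvR : (f v v)^* = f v v by rewrite geC0_conj// ltW.
have [a aE] : exists a, a = f u v / f v v by exists (f u v / f v v).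
have := dnorm_ge0 f (u - a *: v).
rewrite hnormB /= expr0 mul1r dnormZ linearZr_LR /=.
have acE : a^* = (f u v)^* / f v v by rewrite aE rmorphM /= fmorphV /= fvvR.
rewrite normCK [(a^* * _)^*]rmorphM /= conjCK acE normCK => le0.
rewrite -subr_ge0.
have -> : f u u * f v v - f u v * (f u v)^* =
    (f u u + a * ((f u v)^* / f v v) * f v v -
     ((f u v)^* / f v v * f u v + a * (f u v)^*)) * f v v.
  by rewrite aE; field; exact: lt0r_neq0.
by rewrite mulr_ge0// ltW.
Qed.

Lemma dot_triangle (u v : U) :
  sqrtC (f (u + v) (u + v)) <= sqrtC (f u u) + sqrtC (f v v).
Proof.
rewrite -ler_sqr ?nnegrE ?addr_ge0 ?sqrtC_ge0 ?dnorm_ge0//.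
rewrite sqrrD !sqrtCK dnormD /= [leRHS]addrAC lerD2l.
have <- : 'Re (f u v) *+ 2 = f u v + (f u v)^*.
  by rewrite ReE -mulr_natr divfK// pnatr_eq0.
rewrite lerMn2r /=; apply: le_trans (leif_Re_Creal _) _.
rewrite -ler_sqr ?nnegrE ?mulr_ge0 ?sqrtC_ge0 ?dnorm_ge0//.
by rewrite exprMn !sqrtCK dot_CauchySchwarz.
Qed.

Lemma dot_sqrtZ (a : C) (u : U) :
  sqrtC (f (a *: u) (a *: u)) = `|a| * sqrtC (f u u).
Proof.
by rewrite dnormZ sqrtCM ?nnegrE ?exprn_ge0 ?dnorm_ge0// sqrCK.
Qed.

Lemma dot_sqrt_eq0 (u : U) : sqrtC (f u u) = 0 -> u = 0.
Proof. by move/eqP; rewrite sqrtC_eq0 dnorm_eq0 => /eqP. Qed.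

End DotNorm.

Section RealIneq.
Context {K : numFieldType} (y z : K) (y0 : 0 <= y) (z0 : 0 <= z).

Lemma sqrrD_le : (y + z) ^+ 2 <= 2 * (y ^+ 2 + z ^+ 2).
Proof.
rewrite -subr_ge0 (_ : _ - _ = (y - z) ^+ 2); last by ring.
by rewrite real_exprn_even_ge0// rpredB// ger0_real.
Qed.

Lemma mulr_le_sqrD : y * z <= y ^+ 2 + z ^+ 2.
Proof.
rewrite -subr_ge0 (_ : _ - _ = (y - z) ^+ 2 + y * z); last by ring.
apply: addr_ge0; last exact: mulr_ge0.
by rewrite real_exprn_even_ge0// rpredB// ger0_real.
Qed.

End RealIneq.

Definition square_summable (R : realType) (X : choiceType) (f : X -> R[i]) :=
  cvg (partial_sum (fun x => `|f x| ^+ 2) @ totally).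

Section SquareSummable.
Context {R : realType} {X : choiceType}.
Local Notation C := R[i].
Implicit Types (f g : X -> C) (A : {fset X}).

Lemma square_summableP f : square_summable f <->
  exists M, forall A, partial_sum (fun x => `|f x| ^+ 2) A <= M.
Proof.
split=> [cf|[M fM]].
  by exists (sum (fun x => `|f x| ^+ 2)) => A; apply: sum_ge => // x; rewrite exprn_ge0.
apply: (@partial_sum_cvg _ _ _ M) => A; apply: le_trans (fM A).
rewrite !partial_sumE ler_sum// => x _.
by rewrite ger0_norm// exprn_ge0.
Qed.

Lemma square_summable_linear (a : C) f g : square_summable f ->
  square_summable g -> square_summable (a *: f + g).
Proof.
move=> /square_summableP[M fM] /square_summableP[N gN]; apply/square_summableP.
exists (2 * `|a| ^+ 2 * M + 2 * N) => A.
apply: le_trans (lerD (ler_wpM2l _ (fM A)) (ler_wpM2l _ (gN A))) => //.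
rewrite !partial_sumE !mulr_sumr -big_split ler_sum// => x _ /=.
rewrite !fctE -mulrA -exprMn -normrM -mulrDr.
apply: le_trans (sqrrD_le _ _) => //.
by rewrite ler_sqr ?nnegrE ?addr_ge0//; exact: ler_normD.
Qed.

Lemma cvg_inner f g : square_summable f -> square_summable g ->
  cvg (partial_sum (fun x => f x * (g x)^*) @ totally).
Proof.
move=> /square_summableP[M fM] /square_summableP[N gN].
apply: (@partial_sum_cvg _ _ _ (M + N)) => A.
apply: le_trans (lerD (fM A) (gN A)).
rewrite !partial_sumE -big_split ler_sum// => x _ /=.
rewrite normrM norm_conjC.
exact: mulr_le_sqrD.
Qed.

Definition ell2_pred : {pred X -> C} := fun f => `[< square_summable f >].

Lemma ell2_submod_closed : submod_closed ell2_pred.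
Proof.
split=> [|a f g /asboolP ff /asboolP gg].
  apply/asboolP/square_summableP; exists 0 => A.
  by rewrite partial_sumE big1// => x _; rewrite normr0 expr0n.
by apply/asboolP; exact: square_summable_linear.
Qed.

HB.instance Definition _ :=
  GRing.isSubmodClosed.Build C (X -> C) ell2_pred ell2_submod_closed.

End SquareSummable.

Record ell2 (R : realType) (X : choiceType) := Ell2 {
  ell2_fun :> X -> R[i] ;
  _ : ell2_fun \in ell2_pred }.

Section Ell2.
Context {R : realType} {X : choiceType}.
Local Notation C := R[i].
Local Notation T := (ell2 R X).

HB.instance Definition _ := [isSub of T for @ell2_fun R X].
HB.instance Definition _ := [Choice of T by <:].
HB.instance Definition _ := [SubChoice_isSubLmodule of T by <:].

Lemma ell2P (f : T) : square_summable f.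
Proof. exact/asboolP/(valP f). Qed.
#[local] Arguments ell2P f : clear implicits.

Lemma ell2_eq (f g : T) : f =1 g -> f = g.
Proof. by move=> fg; apply/val_inj/funext. Qed.

Definition ell2_inner (f g : T) : C := sum (fun x => f x * (g x)^*).

Lemma ell2_inner_conj (f g : T) : ell2_inner g f = (ell2_inner f g)^*.
Proof.
rewrite /ell2_inner -(sum_conj (cvg_inner (ell2P f) (ell2P g))).
by congr (sum _); apply/funext => x; rewrite rmorphM /= conjCK mulrC.
Qed.

Lemma ell2_inner_linearl (g : T) : linear_for *%R (ell2_inner^~ g).
Proof.
move=> a f h; apply: sumP.
rewrite (_ : (fun x => _) = (fun x => a * (f x * (g x)^*) + h x * (g x)^*)).
  by apply: sum_linear; apply: cvg_inner; exact: ell2P.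
by apply/funext => x; rewrite mulrA -mulrDl.
Qed.

Lemma ell2_inner_linearr (f : T) :
  linear_for (Num.conj \; *%R) (ell2_inner f).
Proof.
move=> a g h /=; rewrite !(ell2_inner_conj _ f) ell2_inner_linearl.
by rewrite rmorphD rmorphM.
Qed.

HB.instance Definition _ := bilinear_isBilinear.Build C T T C *%R
  (Num.conj \; *%R) ell2_inner (ell2_inner_linearl, ell2_inner_linearr).

Lemma ell2_inner_herm (f g : T) :
  ell2_inner f g = (-1) ^+ false * (ell2_inner g f)^*.
Proof. by rewrite expr0 mul1r -ell2_inner_conj. Qed.

HB.instance Definition _ :=
  isHermitianSesquilinear.Build C T false Num.conj ell2_inner ell2_inner_herm.

Lemma ell2_innerE (f : T) : ell2_inner f f = sum (fun x => `|f x| ^+ 2).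
Proof. by congr (sum _); apply/funext => x; rewrite normCK. Qed.

Lemma ell2_inner_gt0 (f : T) : f != 0 -> 0 < ell2_inner f f.
Proof.
move=> f0; rewrite lt_def ell2_innerE.
have sq0 x : 0 <= `|f x| ^+ 2 by rewrite exprn_ge0.
have := sum_ge fset0 sq0 (ell2P f); rewrite partial_sumE big_seq_fset0 => ->.
rewrite andbT; apply: contra f0 => /eqP s0; apply/eqP/ell2_eq => x.
have /eqP := sum_eq0 x sq0 (ell2P f) s0.
by rewrite sqrf_eq0 normr_eq0 => /eqP.
Qed.

HB.instance Definition _ :=
  isDotProduct.Build C T ell2_inner ell2_inner_gt0.

HB.instance Definition _ := Lmodule_isNormed.Build C T
  (dot_triangle ell2_inner) (dot_sqrtZ ell2_inner) (@dot_sqrt_eq0 _ _ ell2_inner).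

Lemma ell2_normE (f : T) : `|f| ^+ 2 = ell2_inner f f.
Proof. exact: sqrtCK. Qed.

Lemma ell2_norm_ge (f : T) (A : {fset X}) :
  partial_sum (fun x => `|f x| ^+ 2) A <= `|f| ^+ 2.
Proof.
rewrite ell2_normE ell2_innerE; apply: sum_ge (ell2P f) => x.
by rewrite exprn_ge0.
Qed.

Lemma ell2_norm_coord (f : T) x : `|f x| <= `|f|.
Proof.
rewrite -ler_sqr ?nnegrE// (le_trans _ (ell2_norm_ge f [fset x]%fset))//.
by rewrite partial_sumE big_seq_fset1.
Qed.

Lemma ell2_norm_le (f : T) (M : C) : 0 <= M ->
  (forall A, partial_sum (fun x => `|f x| ^+ 2) A <= M ^+ 2) -> `|f| <= M.
Proof.
move=> M0 fM; rewrite -ler_sqr ?nnegrE// ell2_normE ell2_innerE.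
by apply: sum_le fM; exact: ell2P.
Qed.

End Ell2.
Arguments ell2P {R X} f.

Lemma cvg_sumC (R : realType) (I : choiceType) (T : Type) (F : set_system T)
    (f : I -> T -> R[i]) (l : I -> R[i]) (r : seq I) : Filter F ->
  (forall i, f i @ F --> l i) ->
  (fun t => \sum_(i <- r) f i t) @ F --> \sum_(i <- r) l i.
Proof.
move=> FF fl; elim: r => [|i r ih].
  by rewrite big_nil; under eq_fun do rewrite big_nil; exact: cvg_cst.
rewrite big_cons; under eq_fun do rewrite big_cons.
by apply: cvgD ih; exact: fl.
Qed.

Section Ell2Complete.
Context {R : realType} {X : choiceType}.
Local Notation C := R[i].
Local Notation T := (ell2 R X).

Lemma ell2_complete (F : set_system T) :
  ProperFilter F -> cauchy F -> cvg F.
Proof.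
move=> FF Fc0; have Fc := (cauchyP F (PF := FF)).1 Fc0.
have coordB (f g : T) x : (f - g) x = f x - g x by [].
have cvgx x : cvg ((fun f : T => f x) @ F).
  apply: complex_complete; apply: cauchy_exP => e e0.
  have [f Ff] := Fc _ e0; exists (f x).
  suff : F ((fun g : T => g x) @^-1` ball (f x) e) by [].
  apply: (filterS _ Ff) => g /=; rewrite -!ball_normE /= => fg.
  by rewrite -coordB (le_lt_trans (ell2_norm_coord _ _)).
pose l x : C := lim ((fun f : T => f x) @ F).
have cvgl x : (fun f : T => f x) @ F --> l x by exact: cvgx.
have Fl e : 0 < e -> \forall g \near F,
    forall A, partial_sum (fun x => `|(g : T) x - l x| ^+ 2) A <= e ^+ 2.
  move=> e0; have e20 : 0 < e / 2 by rewrite divr_gt0// ltr0n.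
  have [h Fh] := Fc _ e20; apply: (filterS _ Fh) => g hg A.
  rewrite -subr_ge0.
  apply: (@cvg_ge0C _ T F (fun k : T =>
    e ^+ 2 - partial_sum (fun x => `|g x - k x| ^+ 2) A)).
    apply: cvgB; first exact: cvg_cst.
    rewrite partial_sumE; under eq_fun do rewrite partial_sumE.
    apply: (@cvg_sumC _ _ _ F (fun x (k : T) => `|g x - k x| ^+ 2)) => x.
    rewrite expr2; under eq_fun do rewrite expr2.
    have gx : (fun k : T => `|g x - k x|) @ F --> `|g x - l x|.
      by apply: cvg_norm; apply: cvgB => //; exact: cvg_cst.
    exact: cvgM.
  apply: (filterS _ Fh) => k hk; rewrite subr_ge0.
  apply: le_trans (ell2_norm_ge (g - k) A) _.
  rewrite ler_sqr ?nnegrE ?(ltW e0)//.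
  have -> : g - k = (h - k) - (h - g) by rewrite opprB [RHS]addrC subrKA.
  apply: le_trans (ler_normB _ _) _; move: hg hk; rewrite -!ball_normE /= => hg hk.
  by rewrite [leRHS]splitr lerD ?ltW.
have lP : l \in ell2_pred.
  have [g gl] := filter_ex (Fl 1 ltr01).
  have glP : square_summable (fun x => g x - l x).
    by apply/square_summableP; exists (1 ^+ 2).
  have lE : (-1) *: (fun x => g x - l x) + (g : X -> C) = l.
    by apply/funext => x; rewrite !fctE scaleN1r opprB subrK.
  apply/asboolP; have := @square_summable_linear _ _ (-1) _ _ glP (ell2P g).
  by rewrite lE.
apply/cvg_ex; exists (Ell2 lP); apply/cvgrPdist_lt => e e0.
have e20 : 0 < e / 2 by rewrite divr_gt0// ltr0n.
apply: (filterS _ (Fl _ e20)) => g gl.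
rewrite (@le_lt_trans _ _ (e / 2))//; last first.
  by rewrite ltr_pdivrMr ?ltr0n// ltr_pMr// ltr1n.
rewrite distrC; apply: ell2_norm_le; first exact: ltW.
by move=> A; exact: gl.
Qed.

HB.instance Definition _ := Uniform_isComplete.Build T ell2_complete.

End Ell2Complete.

(* Complex Hilbert spaces: complete normed spaces whose norm comes from an inner
   product, which is linear in its first argument. *)
HB.mixin Record NormedModule_isHilbert (R : realType) H
    & CompleteNormedModule R[i] H := {
  inner : {dot H for Num.conj} ;
  sqr_normE : forall x : H, `|x| ^+ 2 = inner x x }.

#[short(type="hilbertType")]
HB.structure Definition Hilbert (R : realType) :=
  {H of CompleteNormedModule R[i] H & NormedModule_isHilbert R H}.

HB.instance Definition _ (R : realType) (X : choiceType) :=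
  NormedModule_isHilbert.Build R (ell2 R X) (@ell2_normE R X).

Section Ell2Basis.
Context {R : realType} {X : choiceType}.
Local Notation C := R[i].

Lemma ell2_basis_subproof (x : X) :
  (fun y => (y == x)%:R : C) \in ell2_pred.
Proof.
apply/asboolP/square_summableP; exists 1 => A; rewrite partial_sumE.
have [xA|xA] := boolP (x \in A).
  rewrite (big_fsetD1 x)//= eqxx normr1 expr1n big_seq big1 ?addr0// => y.
  by rewrite !inE => /andP[/negPf->]; rewrite normr0 expr0n.
rewrite big_seq big1// => y yA; case: eqP => [yx|]; first by rewrite -yx yA in xA.
by rewrite normr0 expr0n.
Qed.

Definition ell2_basis (x : X) : ell2 R X := Ell2 (ell2_basis_subproof x).

Lemma ell2_inner_basis (f : ell2 R X) x : inner f (ell2_basis x) = f x.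
Proof.
apply: sumP; have -> : f x = partial_sum (fun y => f y * ((y == x)%:R)^*) [fset x]%fset.
  by rewrite partial_sumE big_seq_fset1 eqxx conjC1 mulr1.
apply: cvg_near_cst; exists [fset x]%fset => // A /=; rewrite fsub1set => xA.
apply/eqP; rewrite !partial_sumE big_seq_fset1 eqxx (big_fsetD1 x)//= eqxx.
rewrite big_seq big1 ?addr0// => y.
by rewrite !inE => /andP[/negPf->]; rewrite conjC0 mulr0.
Qed.

End Ell2Basis.

Section BoundedOperators.
Context {R : realType} {V : normedModType R[i]}.

Definition bounded_op_pred : {pred V -> V} :=
  fun f => `[< linear f /\ continuous f >].

Lemma bounded_op_submod_closed : submod_closed bounded_op_pred.
Proof.
split=> [|a f g /asboolP[fl fc] /asboolP[gl gc]]; apply/asboolP; split.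
- by move=> a x y; rewrite -[RHS]/(a *: 0 + 0) scaler0 addr0.
- by rewrite -[X in continuous X]/(fun _ => 0) => x; exact: cvg_cst.
- move=> b x y; rewrite -[LHS]/(a *: f (b *: x + y) + g (b *: x + y)).
  rewrite -[RHS]/(b *: (a *: f x + g x) + (a *: f y + g y)) fl gl.
  by rewrite !scalerDr !scalerA [a * b]mulrC addrACA.
- rewrite -[X in continuous X]/(fun x => a *: f x + g x) => x.
  by apply: cvgD; [apply: cvgZr; exact: fc|exact: gc].
Qed.

HB.instance Definition _ := GRing.isSubmodClosed.Build R[i] (V -> V)
  bounded_op_pred bounded_op_submod_closed.

End BoundedOperators.

(* The bounded operators on [V], with the operator norm (whose values, like those
   of all norms here, are nonnegative reals embedded in [R[i]]). *)
Record bounded_op (R : realType) (V : normedModType R[i]) := BoundedOp {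
  op_fun :> V -> V ;
  _ : op_fun \in bounded_op_pred }.

Section BoundedOpTheory.
Context {R : realType} {V : normedModType R[i]}.
Local Notation B := (bounded_op V).
Implicit Types S T : B.

HB.instance Definition _ := [isSub of B for @op_fun R V].
HB.instance Definition _ := [Choice of B by <:].
HB.instance Definition _ := [SubChoice_isSubLmodule of B by <:].

Lemma op_linear T : linear T.
Proof. by have /asboolP[] := valP T. Qed.

Lemma op_continuous T : continuous T.
Proof. by have /asboolP[] := valP T. Qed.

HB.instance Definition _ T :=
  GRing.isLinear.Build R[i] V V *:%R T (op_linear T).

Lemma op_comp_subproof S T : (S \o T) \in bounded_op_pred.
Proof.
apply/asboolP; split; first by move=> a x y /=; rewrite !linearP.
by move=> x; apply: continuous_comp; exact: op_continuous.
Qed.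

Definition op_comp S T : B := BoundedOp (op_comp_subproof S T).

Definition op_norm T : R[i] :=
  (sup [set complex.Re `|T x| | x in [set x | `|x| <= 1]])%:C.

Lemma op_norm_has_sup T :
  has_sup [set complex.Re `|T x| | x in [set x | `|x| <= 1]].
Proof.
split; first by exists (complex.Re `|T 0|), 0 => //=; rewrite normr0.
have /linear_boundedP/pinfty_ex_gt0[M M0 TM] :=
  (linear_bounded_continuous T).2 (@op_continuous T).
exists (complex.Re M) => _ [x x1 <-].
have : `|T x| <= M by rewrite (le_trans (TM x))// ler_piMr// ltW.
by rewrite lecE => /andP[].
Qed.

Lemma op_norm_ge T x : `|x| <= 1 -> `|T x| <= op_norm T.
Proof.
move=> x1; rewrite -[leLHS]ger0_Re// lecR; apply: ub_le_sup; last by exists x.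
by case: (op_norm_has_sup T).
Qed.

Lemma op_norm_le T (M : R[i]) : (forall x, `|x| <= 1 -> `|T x| <= M) ->
  op_norm T <= M.
Proof.
move=> TM; have M0 : 0 <= M by rewrite (le_trans _ (TM 0 _)) ?normr0.
rewrite -[leRHS]ger0_Re// lecR.
apply: ge_sup; first by case: (op_norm_has_sup T).
by move=> _ [x x1 <-]; have := TM x x1; rewrite lecE => /andP[].
Qed.

Lemma op_norm_ge0 T : 0 <= op_norm T.
Proof. by rewrite (le_trans _ (@op_norm_ge T 0 _)) ?normr0. Qed.

Lemma op_normD S T : op_norm (S + T) <= op_norm S + op_norm T.
Proof.
apply: op_norm_le => x x1; apply: le_trans (ler_normD _ _) _.
by rewrite lerD ?op_norm_ge.
Qed.

Let op_normZ_le a T : op_norm (a *: T) <= `|a| * op_norm T.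
Proof.
apply: op_norm_le => x x1; rewrite [_ x]/(a *: T x) normrZ.
by rewrite ler_wpM2l// op_norm_ge.
Qed.

Lemma op_normZ a T : op_norm (a *: T) = `|a| * op_norm T.
Proof.
apply/eqP; rewrite eq_le op_normZ_le /=; have [->|a0] := eqVneq a 0.
  by rewrite normr0 mul0r op_norm_ge0.
have := op_normZ_le a^-1 (a *: T); rewrite scalerA mulVf// scale1r normfV.
by rewrite -ler_pdivrMl ?invr_gt0 ?normr_gt0// invrK.
Qed.

Lemma op_norm_eq0 T : op_norm T = 0 -> T = 0.
Proof.
move=> T0; apply/val_inj/funext => x /=.
have [->|x0] := eqVneq x 0; first by rewrite linear0.
have : `|T (`|x|^-1 *: x)| <= 0.
  rewrite -T0 op_norm_ge// normrZ ger0_norm ?invr_ge0//.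
  by rewrite mulVf// normr_eq0.
by rewrite normr_le0 linearZ /= scaler_eq0 invr_eq0 normr_eq0 (negPf x0) => /eqP.
Qed.

HB.instance Definition _ :=
  Lmodule_isNormed.Build R[i] B op_normD op_normZ op_norm_eq0.

End BoundedOpTheory.

(* The weak operator topology on [bounded_op H]: the coarsest topology making
   T |-> <T x, y> continuous for all x and y. *)
Definition wot (R : realType) (H : hilbertType R) : topologicalType :=
  initial_topology (fun T : bounded_op H =>
    (fun xy : H * H => inner (T xy.1) xy.2) : {ptws H * H -> R[i]}).

Definition wot_closure (R : realType) (H : hilbertType R)
    (A : set (bounded_op H)) : set (bounded_op H) :=
  @closure (wot H) A.

Definition is_subalgebra (R : realType) (H : hilbertType R)
    (A : set (bounded_op H)) :=
  [/\ A 0,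
      forall S T, A S -> A T -> A (S + T),
      forall (a : R[i]) T, A T -> A (a *: T) &
      forall S T, A S -> A T -> A (op_comp S T)].

Definition wot_generated_algebra (R : realType) (H : hilbertType R)
    (G : set (bounded_op H)) : set (bounded_op H) :=
  wot_closure (smallest (@is_subalgebra R H) G).

(* A partial injection phi : X -> X, with inverse ext, induces the partial
   isometry f |-> f o phi of l^2(X), read as 0 where phi is undefined. *)
Section Pullback.
Context {R : realType} {X : choiceType}.
Context (phi : X -> option X) (ext : X -> X) (phiK : ocancel phi ext).
Local Notation C := R[i].

Lemma pullback_partial_sum (f : ell2 R X) (A : {fset X}) :
  partial_sum (fun y => `|oapp f 0 (phi y)| ^+ 2) A <= `|f| ^+ 2.
Proof.
apply: le_trans (ell2_norm_ge f [fset x in pmap phi A]%fset).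
rewrite !partial_sumE.
have -> : \sum_(y <- A) `|oapp f 0 (phi y)| ^+ 2 =
          \sum_(x <- pmap phi A) `|f x| ^+ 2.
  elim: (enum_fset A) => [|y s ih]; first by rewrite !big_nil.
  rewrite big_cons ih /=; case: (phi y) => [x|] /=; first by rewrite big_cons.
  by rewrite normr0 expr0n add0r.
rewrite (perm_big [fset x in pmap phi A]%fset)//=.
by apply: uniq_perm => [||x]; rewrite ?(pmap_uniq phiK)// !inE.
Qed.

Lemma pullback_subproof (f : ell2 R X) :
  (fun y => oapp f 0 (phi y)) \in ell2_pred.
Proof.
apply/asboolP/square_summableP; exists (`|f| ^+ 2) => A.
exact: pullback_partial_sum.
Qed.

Definition pullback (f : ell2 R X) : ell2 R X := Ell2 (pullback_subproof f).

Lemma pullback_linear : linear pullback.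
Proof.
move=> a f g; apply: ell2_eq => y.
rewrite -[RHS]/(a *: pullback f y + pullback g y) /=.
by case: (phi y) => [x|] //=; rewrite scaler0 addr0.
Qed.

HB.instance Definition _ :=
  GRing.isLinear.Build C (ell2 R X) (ell2 R X) *:%R pullback pullback_linear.

Lemma pullback_bounded : (pullback : ell2 R X -> ell2 R X) \in bounded_op_pred.
Proof.
apply/asboolP; split; first exact: pullback_linear.
apply: (linear_bounded_continuous pullback).1.
apply/linear_boundedP; near=> r => f; apply: (@le_trans _ _ `|f|).
  by apply: ell2_norm_le => // A; exact: pullback_partial_sum.
by rewrite ler_peMl//; near: r; exact: nbhs_pinfty_ge.
Unshelve. all: by end_near. Qed.

Definition pullback_op : bounded_op (ell2 R X) := BoundedOp pullback_bounded.

End Pullback.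

Record digraph := Digraph {
  vertex : countType ;
  edge : countType ;
  edge_src : edge -> vertex ;
  edge_rng : edge -> vertex }.

Section Paths.
Context (G : digraph).
Local Notation V := (vertex G).
Local Notation E := (edge G).

Fixpoint is_path (x : V) (s : seq E) :=
  if s is e :: s' then (edge_src e == x) && is_path (edge_rng e) s' else true.

Definition path_end (x : V) (s : seq E) := last x (map (@edge_rng G) s).

Lemma is_path_cat x s t :
  is_path x (s ++ t) = is_path x s && is_path (path_end x s) t.
Proof. by elim: s x => //= e s ih x; rewrite ih andbA. Qed.

(* A path is a source vertex with a sequence of edges listed in order of travel:
   the path written e_k ... e_2 e_1 is (s(e_1), [:: e_1; e_2; ...; e_k]), and the
   vertex x, seen as a path of length 0, is (x, [::]). *)
Record gpath := GPath {
  gpath_val : V * seq E ;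
  _ : is_path gpath_val.1 gpath_val.2 }.

HB.instance Definition _ := [isSub for gpath_val].
HB.instance Definition _ := [Countable of gpath by <:].

Definition psrc (p : gpath) : V := (val p).1.
Definition pedges (p : gpath) : seq E := (val p).2.
Definition prng (p : gpath) : V := path_end (psrc p) (pedges p).

Definition pvertex (x : V) : gpath := @GPath (x, [::]) isT.

(* The product pq (first q, then p); only meaningful when s(p) = r(q). *)
Definition pmul (p q : gpath) : gpath :=
  insubd q (psrc q, pedges q ++ pedges p).

Lemma val_pmul p q : psrc p = prng q ->
  val (pmul p q) = (psrc q, pedges q ++ pedges p).
Proof.
move=> pq; rewrite val_insubd /= is_path_cat -[path_end _ _]/(prng q) -pq.
by rewrite (valP p) (valP q).
Qed.

(* The path w such that u = pw, if there is one. *)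
Definition pquot (p u : gpath) : option gpath :=
  obind (fun w => if (psrc p == prng w) && (pmul p w == u) then Some w else None)
    (insub (psrc u, take (size (pedges u) - size (pedges p)) (pedges u))).

Lemma pquotK p : ocancel (pquot p) (pmul p).
Proof.
move=> u; rewrite /pquot; case: insub => //= w.
by case: ifP => //= /andP[_ /eqP].
Qed.

Lemma pquotP p u w :
  (pquot p u == Some w) = (psrc p == prng w) && (pmul p w == u).
Proof.
apply/eqP/andP => [|[/eqP pw /eqP <-]].
  rewrite /pquot; case: insub => //= v; case: ifP => // /andP[pv vu] [<-].
  by split.
rewrite /pquot /psrc /pedges val_pmul//= size_cat addnK take_size_cat//.
rewrite -[(psrc w, pedges w)]/((val w).1, (val w).2) -surjective_pairing valK /=.
by rewrite -/(psrc p) pw !eqxx.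
Qed.

Definition transitive_graph :=
  forall x y : V, x != y -> exists p : gpath, psrc p = x /\ prng p = y.

Definition cycle_graph :=
  exists n : nat, (0 < n)%N /\
    exists (x : 'I_n -> V) (e : 'I_n -> E),
      [/\ bijective x, bijective e,
          forall i, edge_src (e i) = x i &
          forall i, edge_rng (e i) = x (ordS i)].

Definition trivial_graph :=
  (exists x : V, forall y : V, y = x) /\ (E -> False).

Definition strongly_transitive :=
  [/\ ~ trivial_graph, transitive_graph & ~ cycle_graph].

End Paths.

(* [creation p] is the operator L_p; see [creation_basis]. *)
Section FreeSemigroupoidAlgebra.
Context {R : realType}.
Context (G : digraph).

Definition creation (p : gpath G) : bounded_op (ell2 R (gpath G)) :=
  pullback_op (pquotK p).

Lemma creation_basis (p w : gpath G) :
  creation p (ell2_basis w) =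
  if psrc p == prng w then ell2_basis (pmul p w) else 0.
Proof.
apply: ell2_eq => u.
have -> : creation p (ell2_basis w) u = (pquot p u == Some w)%:R.
  by rewrite /=; case: (pquot p u).
rewrite pquotP; case: ifP => //= _.
by rewrite eq_sym.
Qed.

Definition free_semigroupoid_algebra : set (bounded_op (ell2 R (gpath G))) :=
  wot_generated_algebra (range creation).

End FreeSemigroupoidAlgebra.
Arguments free_semigroupoid_algebra : clear implicits.

(* A representation of the operator algebra A on H is the restriction to A of a
   function on all of [bounded_op K], whose values outside A are irrelevant. *)
Section Representations.
Context {R : realType} {K H : hilbertType R}.
Context (A : set (bounded_op K)) (rho : bounded_op K -> bounded_op H).

Definition representation :=
  [/\ forall S T, A S -> A T -> rho (S + T) = rho S + rho T,
      forall (a : R[i]) T, A T -> rho (a *: T) = a *: rho T,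
      forall S T, A S -> A T -> rho (op_comp S T) = op_comp (rho S) (rho T) &
      {within A, continuous rho}].

Definition faithful := forall S T, A S -> A T -> rho S = rho T -> S = T.

Definition irreducible := wot_closure (rho @` A) = [set: bounded_op H].

End Representations.

(* Main.v *)
Require Import Defs.
From HB Require Import structures.
From mathcomp Require Import all_boot all_order all_algebra finmap.
From mathcomp Require Import all_classical all_reals all_analysis.
From mathcomp Require Import complex summability ring lra zify.

(** Write A for the free semigroupoid algebra of G.

Necessity.  An identity L_a L_p L_b = z L_c L_p L_d that holds for every path p
holds with any element of A in place of L_p, and then, when rho is irreducible,
rho(L_a) T rho(L_b) = z rho(L_c) T rho(L_d) for every bounded T
([rep_relation]): matrix coefficients pass to weak limits, and the outer factors
are moved to the other side of the inner product by adjoints, which exist by the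
Riesz theorem.  Rank one operators T then make such identities very rigid.
Without a path from x to y one has L_y L_p L_x = 0 for all p, so rho kills L_x or
L_y ([rep_transitive]).  In a cycle graph closed paths at a vertex x commute, so
L_c L_p L_x = L_x L_p L_c for a closed path c at x, which makes rho(L_c) a
multiple of rho(L_x) ([rep_no_commuting_cycle]).  Both contradict faithfulness.

Sufficiency.  Let the edges of G act on a countable set X of states, each
carrying a vertex as label, and give each pair (edge, state) a positive weight.
A path w with the label of x as source acts by
    T_w xi_x = (product of the weights met along w) xi_(w.x).
When the squares of the weights have a small sum, the map sending
xi_w (x) xi_x to T_w xi_x is bounded on the whole of l^2(paths * X)
([evaluate]), so that w |-> T_w extends from paths to A by
    A |-> (xi_x |-> evaluate (A xi_(lab x) (x) xi_x)),
without any convergence argument ([weighted_rep]).  It remains to choose the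
action and the weights.

A nonempty strongly transitive graph has two edges e1 <> e2 with a common source.
The states are edge sequences u of paths starting at the range of e2.  An edge e
turns u into u e, except that e2 sends certain states, the resetting ones, back to
the empty sequence, called the root.  Words without e2 never reset, and a
resetting state is either one fixed word tail0, or y e2 t where the word t,
itself without e2, encodes y; thus y is recovered from the last occurrence of e2.
This yields:
 - for every state w a word, [separator], that takes w to the root and every other
   state with the same label to a state ending in e2;
 - a word, [home], that fixes the root and takes states ending in e2 to states
   ending in e2.  The steps from the root along home get the largest weight, so the
   normalized products T_home^n T_separator converge in norm to the matrix unit
   taking xi_w to the vector of the root.  As every state can be reached from the
   root, all matrix units are limits of operators T_p, and they span a weakly
   dense space ([state_irreducible]);
 - for every path w0, arbitrarily long states u from which w0 runs without reset.
   Any other word with the same effect on u must first return to the root and then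
   spell u w0, hence has a weight smaller by a factor 2^-|u|.  So the coefficient
   of w0 in an element of A can be read off from its image under the
   representation ([state_faithful]). *)

Set Implicit Arguments.
Unset Strict Implicit.
Unset Printing Implicit Defensive.

Import Order.TTheory GRing.Theory Num.Theory.
Import numFieldNormedType.Exports.

Local Open Scope classical_set_scope.
Local Open Scope complex_scope.
Local Open Scope ring_scope.

(** * Inner products and the Riesz representation theorem *)

Section InnerProduct.

Context {R : realType} {H : hilbertType R}.

Local Notation C := R[i].

Lemma norm_inner_le (x y : H) : `|inner x y| <= `|x| * `|y|.
Proof.
rewrite -ler_sqr ?nnegrE ?mulr_ge0// exprMn !sqr_normE.
exact: dot_CauchySchwarz.
Qed.

Lemma innerC (x y : H) : inner y x = (inner x y)^*.
Proof. by rewrite hermC expr0 mul1r. Qed.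

Lemma innerDl (x y z : H) : inner (x + y) z = inner x z + inner y z.
Proof. exact: linearDl. Qed.

Lemma innerBl (x y z : H) : inner (x - y) z = inner x z - inner y z.
Proof. exact: linearBl. Qed.

Lemma innerZl (a : C) (x z : H) : inner (a *: x) z = a * inner x z.
Proof. exact: linearZl_LR. Qed.

Lemma inner0l (z : H) : inner 0 z = 0 :> C.
Proof. exact: linear0l. Qed.

Lemma innerDr (x y z : H) : inner x (y + z) = inner x y + inner x z.
Proof. exact: linearDr. Qed.

Lemma innerZr (a : C) (x z : H) : inner x (a *: z) = a^* * inner x z.
Proof. exact: linearZr_LR. Qed.

Lemma inner_suml (I : Type) (r : seq I) (F : I -> H) x :
  inner (\sum_(i <- r) F i) x = \sum_(i <- r) inner (F i) x.
Proof. exact: linear_sumlz. Qed.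

Lemma inner_sumr (I : Type) (r : seq I) (F : I -> H) x :
  inner x (\sum_(i <- r) F i) = \sum_(i <- r) inner x (F i).
Proof. exact: linear_sumr. Qed.

Lemma parallelogram (x y : H) :
  `|x - y| ^+ 2 = (`|x| ^+ 2 + `|y| ^+ 2) *+ 2 - `|x + y| ^+ 2.
Proof.
rewrite !sqr_normE dnormB dnormD /=; ring.
Qed.

(** The multiple t k that best approximates - u is - <u, k> / <k, k> k; it lowers the norm
    of u strictly unless <u, k> = 0. *)
Lemma minimal_norm_ortho (u k : H) :
  (forall t : C, `|u| ^+ 2 <= `|u + t *: k| ^+ 2) -> inner u k = 0.
Proof.
move=> umin; have [->|k0] := eqVneq k 0; first by rewrite linear0r.
have k2 : 0 < inner k k by rewrite dnorm_gt0.
have kR : (inner k k)^* = inner k k by rewrite geC0_conj// ltW.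
have := umin (- (inner u k / inner k k)); rewrite !sqr_normE dnormD /=.
rewrite dnormZ linearZr_LR /= -addrA lerDl normrN normrM normfV exprMn exprVn.
rewrite rmorphN rmorphM /= fmorphV /= kR (ger0_norm (ltW k2)).
rewrite normCK.
set a := inner u k.
rewrite rmorphM rmorphN rmorphM /= fmorphV /= kR conjCK.
have -> : a * a^* / inner k k ^+ 2 * inner k k +
  (- (a^* / inner k k) * a + - (a / inner k k) * a^*) = - (a * a^* / inner k k).
  field; exact: lt0r_neq0.
rewrite -normCK oppr_ge0 pmulr_lle0 ?invr_gt0// => h.
apply/eqP; rewrite -normr_eq0 -sqrf_eq0 eq_le h /=.
by rewrite exprn_ge0.
Qed.

End InnerProduct.

Section Riesz.

Context {R : realType} {H : hilbertType R}.

Local Notation C := R[i].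

Local Notation re := (@complex.Re R).

Lemma gt0_Re (z : C) : 0 < z -> (re z)%:C = z.
Proof. by move=> z0; rewrite ger0_Re// ltW. Qed.

(** Norms take values in R[i]; the squared norm is moved to R, where infima exist. *)
Definition nsq (h : H) : R := re (`|h| ^+ 2).

Lemma nsqE (h : H) : `|h| ^+ 2 = (nsq h)%:C.
Proof. by rewrite ger0_Re// exprn_ge0. Qed.

Lemma nsq_ge0 (h : H) : 0 <= nsq h.
Proof. by rewrite -lecR -nsqE exprn_ge0. Qed.

Lemma nsq_parallelogram (x y : H) :
  nsq (x - y) = 2 * nsq x + 2 * nsq y - nsq (x + y).
Proof.
apply: complexI; rewrite -nsqE parallelogram !nsqE -rmorphD -rmorphMn -rmorphB /=.
by congr (_%:C); lra.
Qed.

Lemma nsq_half (x : H) : nsq x = 4 * nsq (2%:R^-1 *: x).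
Proof.
apply: complexI; rewrite rmorphM /= -!nsqE.
rewrite normrZ exprMn normfV normr_nat exprVn mulrA.
have -> : 4%:C = 2 ^+ 2 :> C by rewrite -natrX rmorph_nat.
by rewrite divff ?mul1r// expf_neq0// pnatr_eq0.
Qed.

Section Functional.
Variables (phi : H -> C) (M : C).
Hypothesis phiP : forall a x y, phi (a *: x + y) = a * phi x + phi y.
Hypothesis phiM : forall h, `|phi h| <= M * `|h|.

Lemma functional0 : phi 0 = 0.
Proof. by have := phiP (-1) 0 0; rewrite scaler0 addr0 mulN1r addNr. Qed.

Lemma functionalZ a x : phi (a *: x) = a * phi x.
Proof. by have := phiP a x 0; rewrite functional0 !addr0. Qed.

Lemma functionalB x y : phi (x - y) = phi x - phi y.
Proof. by have := phiP (-1) y x; rewrite scaleN1r addrC mulN1r [RHS]addrC. Qed.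

(** The vectors of almost minimal norm on the hyperplane phi = 1 form a Cauchy filter, by the
    parallelogram law: midpoints of such vectors are still on the hyperplane. *)
Lemma minimal_norm_exists (h0 : H) : phi h0 = 1 ->
  exists2 u, phi u = 1 & forall h, phi h = 1 -> `|u| ^+ 2 <= `|h| ^+ 2.
Proof.
move=> ph0.
pose N := [set nsq h | h in [set h | phi h = 1]].
pose d := inf N.
have N_has : has_lbound N by exists 0 => _ [k _ <-]; exact: nsq_ge0.
have N_lb h : phi h = 1 -> d <= nsq h by move=> ph; apply: ge_inf => //; exists h.
pose B (e : R) : set H := [set h | phi h = 1 /\ nsq h < d + e].
pose F := filter_from [set e : R | 0 < e] B.
have FF : ProperFilter F.
  apply: filter_from_proper; last first.
    move=> e e0.
    have hN : has_inf N by split=> //; exists (nsq h0), h0.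
    have [_ [h ph <-] hd] := inf_adherent e0 hN.
    by exists h.
  apply: filter_from_filter; first by exists 1 => /=.
  move=> e1 e2 /= e10 e20; exists (Num.min e1 e2); first by rewrite /= lt_min e10.
  move=> h [ph]; rewrite -ltrBlDl lt_min => /andP[h1 h2].
  by split; split=> //; rewrite -ltrBlDl.
have Bdist (e : R) x y : B e x -> B e y -> nsq (x - y) < 4 * e.
  move=> [px xd] [py yd].
  have hxy : d <= nsq (2%:R^-1 *: (x + y)).
    by apply: N_lb; rewrite functionalZ -[x]scale1r phiP px py mulr1 mulVf// pnatr_eq0.
  rewrite nsq_parallelogram (nsq_half (x + y)); lra.
have Fc : cauchy F.
  apply: cauchy_exP => e e0.
  pose r := complex.Re e.
  have eE : e = r%:C by rewrite gt0_Re.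
  have r0 : 0 < r by rewrite -ltcR -eE.
  have r20 : 0 < r ^+ 2 / 4 by rewrite divr_gt0// exprn_gt0.
  have [x Bx] : exists x, B (r ^+ 2 / 4) x.
    by apply: (@filter_ex _ F); exists (r ^+ 2 / 4).
  exists x; exists (r ^+ 2 / 4) => // y By /=; rewrite -ball_normE /=.
  rewrite -ltr_sqr ?nnegrE//; last exact: ltW.
  rewrite nsqE eE -rmorphXn ltcR.
  by have := Bdist _ _ _ Bx By; rewrite mulrC divfK// pnatr_eq0.
have /cvg_ex[u Fu] : cvg F by exact: cauchy_cvg.
have M0 : 0 <= M.
  have := le_trans (normr_ge0 _) (phiM h0).
  rewrite pmulr_lge0// normr_gt0; apply/eqP => h00; move/eqP: ph0.
  by rewrite h00 functional0 eq_sym oner_eq0.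
exists u.
  apply/eqP; rewrite -subr_eq0 -normr_le0; apply/ler_addgt0Pr => e e0.
  rewrite add0r; have M1 : 0 < M + 1 by rewrite ltr_wpDl.
  have : \forall h \near F, `|u - h| < e / (M + 1).
    have /cvgrPdist_lt : (fun h : H => h) @ F --> u by exact: Fu.
    by apply; rewrite divr_gt0.
  have : \forall h \near F, phi h = 1 by exists 1 => //= h [].
  move=> F1 F2; have [h [ph hu]] := filter_ex (filterI F1 F2).
  rewrite -ph -functionalB (le_trans (phiM _))//.
  apply: (@le_trans _ _ ((M + 1) * `|u - h|)).
    by rewrite ler_wpM2r// lerDl.
  by rewrite mulrC -ler_pdivlMr// ltW.
move=> h ph; rewrite !nsqE lecR.
apply: le_trans (N_lb _ ph); apply/ler_addgt0Pr => e e0.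
rewrite -lecR -nsqE.
rewrite -subr_ge0; apply: (@cvg_ge0C _ _ F (fun k => (d + e)%:C - `|k| ^+ 2)).
  apply: cvgB; first exact: cvg_cst.
  rewrite expr2; under eq_fun do rewrite expr2.
  by apply: cvgM; apply: cvg_norm.
exists e => //= k [_ kd].
by rewrite subr_ge0 nsqE lecR ltW.
Qed.

(** The vector u of minimal norm with phi u = 1 is orthogonal to the kernel of phi, so phi
    is the inner product with u / <u, u>. *)
Lemma riesz : exists z, forall h, phi h = inner h z.
Proof.
have [ph0|] := pselect (forall h, phi h = 0).
  by exists 0 => h; rewrite linear0r.
move=> /existsNP[h1 /eqP ph1].
have [u pu umin] : exists2 u, phi u = 1 & forall h, phi h = 1 -> `|u| ^+ 2 <= `|h| ^+ 2.
  apply: (@minimal_norm_exists ((phi h1)^-1 *: h1)).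
  by rewrite functionalZ mulVf.
have uu0 : inner u u != 0.
  rewrite dnorm_eq0; apply/eqP => u0; move/eqP: pu.
  by rewrite u0 functional0 eq_sym oner_eq0.
exists ((inner u u)^-1 *: u) => h.
have : inner u (h - phi h *: u) = 0.
  apply: minimal_norm_ortho => t; apply: umin.
  by rewrite addrC phiP functionalB functionalZ pu mulr1 subrr mulr0 add0r.
move=> /(congr1 (@Num.conj _)); rewrite -innerC conjC0 linearBl linearZl_LR.
move/eqP; rewrite subr_eq0 => /eqP hu.
rewrite linearZr_LR /= hu fmorphV /= -innerC.
by rewrite mulrCA mulVf ?mulr1.
Qed.

End Functional.

End Riesz.

(** * Finitely supported vectors of l^2 *)

Section FiniteVectors.
Context {R : realType} {X : choiceType}.
Local Notation C := R[i].
Local Notation basis := (@ell2_basis R X).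
Implicit Types (c : X -> C) (f g : ell2 R X) (A : {fset X}).

Lemma inner_basisl f x : inner (basis x) f = (f x)^*.
Proof. by rewrite innerC ell2_inner_basis. Qed.

Lemma ell2_basisE x y : basis x y = (y == x)%:R.
Proof. by []. Qed.

Lemma ell2_basis_neq0 x : basis x != 0.
Proof.
apply/eqP => /(congr1 (fun f : ell2 R X => f x)); rewrite ell2_basisE eqxx.
by move=> /eqP; rewrite oner_eq0.
Qed.

Lemma ell2_basis_norm x : `|basis x| = 1.
Proof.
apply/eqP; rewrite -(@eqrXn2 _ 2)// expr1n sqr_normE ell2_inner_basis.
by rewrite ell2_basisE eqxx.
Qed.

Lemma ell2_coordZ (a : C) f x : (a *: f) x = a * f x. Proof. by []. Qed.

Lemma ell2_coordB f g x : (f - g) x = f x - g x. Proof. by []. Qed.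

Lemma ell2_coordP (a : C) f g x : (a *: f + g) x = a * f x + g x. Proof. by []. Qed.

Definition fin_vec c A : ell2 R X := \sum_(x <- A) c x *: basis x.

Lemma fin_vec_inner c A g : inner (fin_vec c A) g = \sum_(x <- A) c x * (g x)^*.
Proof.
rewrite /fin_vec (linear_sumlz (inner : {dot ell2 R X for Num.conj})).
by apply: eq_bigr => x _; rewrite linearZl_LR /= inner_basisl.
Qed.

Lemma fin_vec_coord c A y : fin_vec c A y = if y \in A then c y else 0.
Proof.
rewrite -ell2_inner_basis fin_vec_inner; case: ifP => yA.
  rewrite (big_fsetD1 y)//= eqxx conjC1 mulr1 big_seq big1 ?addr0// => x.
  by rewrite !inE => /andP[/negPf]; rewrite eq_sym => ->; rewrite conjC0 mulr0.
rewrite big_seq big1// => x xA /=; case: eqP => [xy|]; first by rewrite xy yA in xA.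
by rewrite conjC0 mulr0.
Qed.

Lemma fin_vec_norm c A : `|fin_vec c A| ^+ 2 = \sum_(x <- A) `|c x| ^+ 2.
Proof.
rewrite sqr_normE fin_vec_inner big_seq [RHS]big_seq.
by apply: eq_bigr => x xA; rewrite fin_vec_coord xA -normCK.
Qed.

Lemma fin_vec_norm_le f A : `|fin_vec f A| <= `|f|.
Proof.
rewrite -ler_sqr ?nnegrE// fin_vec_norm -partial_sumE; exact: ell2_norm_ge.
Qed.

(** The squared distance of f to its truncation to A is the tail of the sum of |f x|^2
    outside A. *)
Lemma fin_vec_near f (e : C) : 0 < e -> \forall A \near totally, `|f - fin_vec f A| < e.
Proof.
move=> e0; have e20 : 0 < (e / 2) ^+ 2 by rewrite exprn_gt0// divr_gt0.
pose u := fun x => `|f x| ^+ 2.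
have cu : partial_sum u @ totally --> `|f| ^+ 2.
  by rewrite ell2_normE ell2_innerE; exact: ell2P f.
have /cvgrPdist_lt/(_ _ e20) := cu.
apply: filterS => A fA; apply: (@le_lt_trans _ _ (e / 2)); last first.
  by rewrite ltr_pdivrMr ?ltr0n// ltr_pMr// ltr1n.
apply: ell2_norm_le => [|B]; first by rewrite ltW// divr_gt0.
have -> : partial_sum (fun x => `|(f - fin_vec f A) x| ^+ 2) B
    = partial_sum u (B `\` A)%fset.
  rewrite !partial_sumE (eq_bigr (fun x => if x \in A then 0 else u x)); last first.
    move=> x _; rewrite ell2_coordB fin_vec_coord.
    by case: ifP => _; rewrite ?subr0// subrr normr0 expr0n.
  rewrite (big_fsetID _ (mem A)) /= [X in X + _]big_seq [X in X + _]big1 ?add0r.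
    apply: eq_fbig => x; first by rewrite !inE andbC.
    by rewrite !inE => /andP[_ /negPf ->].
  by move=> x; rewrite !inE => /andP[_ ->].
have BA : (B `\` A)%fset = ((A `|` B) `\` A)%fset by rewrite fsetDUl fsetDv fset0U.
rewrite BA -partial_sumB ?fsubsetUl//.
apply: le_trans (ltW fA).
rewrite ger0_norm ?subr_ge0; last exact: ell2_norm_ge.
by rewrite lerD2r; exact: ell2_norm_ge.
Qed.

Lemma fin_vec_approx f (e : C) : 0 < e -> exists A, `|f - fin_vec f A| < e.
Proof. by move=> e0; exact: filter_ex (fin_vec_near f e0). Qed.

(** By the Riesz theorem phi is the inner product with some z, and the values of phi on the
    basis are the conjugates of the coordinates of z. *)
Lemma functional_eq0 (phi : ell2 R X -> C) (M : C) :
  (forall a x y, phi (a *: x + y) = a * phi x + phi y) ->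
  (forall h, `|phi h| <= M * `|h|) ->
  (forall x, phi (basis x) = 0) -> forall h, phi h = 0.
Proof.
move=> phiP phiM phi0 h; have [z phiz] := riesz phiP phiM.
rewrite phiz; suff -> : z = 0 by rewrite linear0r.
apply: ell2_eq => x; apply: (can_inj (@conjCK _)).
by rewrite -inner_basisl -phiz phi0 conjC0.
Qed.

Lemma sum_CauchySchwarz (a b : X -> C) A : (forall x, 0 <= a x) -> (forall x, 0 <= b x) ->
  (\sum_(x <- A) a x * b x) ^+ 2 <=
  (\sum_(x <- A) a x ^+ 2) * \sum_(x <- A) b x ^+ 2.
Proof.
move=> a0 b0; have := dot_CauchySchwarz inner (fin_vec a A) (fin_vec b A).
rewrite -!sqr_normE !fin_vec_norm fin_vec_inner ger0_norm; last first.
  by rewrite sumr_ge0// => x _; rewrite fin_vec_coord; case: ifP => _;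
    rewrite ?geC0_conj ?conjC0 ?mulr0// mulr_ge0.
have E c : (forall x, 0 <= c x) -> \sum_(x <- A) `|c x| ^+ 2 = \sum_(x <- A) c x ^+ 2.
  by move=> c0; apply: eq_bigr => x _; rewrite ger0_norm.
rewrite !E//; congr (_ ^+ 2 <= _); rewrite big_seq [RHS]big_seq.
by apply: eq_bigr => x xA; rewrite fin_vec_coord xA geC0_conj.
Qed.

End FiniteVectors.

(** * Bounded operators and the weak operator topology *)

Section OperatorBounds.
Context {R : realType}.
Local Notation C := R[i].

Lemma op0E (V : normedModType C) h : (0 : bounded_op V) h = 0. Proof. by []. Qed.

Lemma opDE (V : normedModType C) (S T : bounded_op V) h : (S + T) h = S h + T h.
Proof. by []. Qed.

Lemma opBE (V : normedModType C) (S T : bounded_op V) h : (S - T) h = S h - T h.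
Proof. by []. Qed.

Lemma opZE (V : normedModType C) (a : C) (T : bounded_op V) h : (a *: T) h = a *: T h.
Proof. by []. Qed.

Lemma op_compE (V : normedModType C) (S T : bounded_op V) h : op_comp S T h = S (T h).
Proof. by []. Qed.

Lemma op_sumE (V : normedModType C) (I : Type) (r : seq I) (F : I -> bounded_op V) h :
  (\sum_(i <- r) F i) h = \sum_(i <- r) F i h.
Proof.
elim: r => [|i r ih]; first by rewrite !big_nil op0E.
by rewrite !big_cons opDE ih.
Qed.

Lemma op_norm_le_mul (V : normedModType C) (T : bounded_op V) f :
  `|T f| <= op_norm T * `|f|.
Proof.
have [->|f0] := eqVneq f 0; first by rewrite linear0 !normr0 mulr0.
have fgt0 : 0 < `|f| by rewrite normr_gt0.
rewrite -ler_pdivrMr// mulrC -[X in X * _]ger0_norm ?invr_ge0//.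
rewrite -normrZ -linearZ; apply: op_norm_ge.
by rewrite normrZ ger0_norm ?invr_ge0// mulVf// normr_eq0.
Qed.

Lemma op_inner_le (H : hilbertType R) (T : bounded_op H) f g :
  `|inner (T f) g| <= op_norm T * `|f| * `|g|.
Proof.
by apply: le_trans (norm_inner_le _ _) _; rewrite ler_wpM2r// op_norm_le_mul.
Qed.

Lemma op_ext (V : normedModType C) (S T : bounded_op V) : S =1 T -> S = T.
Proof. by move=> ST; apply/val_inj/funext. Qed.

Lemma bounded_linear_continuous (V W : normedModType C) (f : {linear V -> W}) (M : C) :
  0 <= M -> (forall x, `|f x| <= M * `|x|) -> continuous f.
Proof.
move=> M0 fM; apply: (linear_bounded_continuous f).1.
apply/linear_boundedP; near=> r => x; apply: (le_trans (fM x)).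
by rewrite ler_wpM2r//; near: r; apply: nbhs_pinfty_ge; exact: ger0_real.
Unshelve. all: by end_near. Qed.

Lemma op_ext_basis (X : choiceType) (S T : bounded_op (ell2 R X)) :
  (forall x, S (ell2_basis x) = T (ell2_basis x)) -> S = T.
Proof.
move=> ST; apply: op_ext => h; apply: ell2_eq => y.
apply/eqP; rewrite -subr_eq0; apply/eqP.
apply: (@functional_eq0 _ _ (fun h => S h y - T h y) (op_norm S + op_norm T)).
- by move=> a f g; rewrite (linearP S) (linearP T) !ell2_coordP mulrBr opprD addrACA.
- move=> f; apply: le_trans (ler_normB _ _) _.
  by rewrite mulrDl lerD// (le_trans (ell2_norm_coord _ _))// op_norm_le_mul.
- by move=> x; rewrite ST subrr.
Qed.

(** Bound of Hilbert-Schmidt type: on a finitely supported f, the norm of T f is at most the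
    sum of |f x| al x, to which the Cauchy-Schwarz inequality applies. *)
Lemma op_bound_basis (X : choiceType) (T : bounded_op (ell2 R X)) (al : X -> C) (k : C) :
  0 <= k -> (forall x, `|T (ell2_basis x)| <= al x) ->
  (forall A : {fset X}, \sum_(x <- A) al x ^+ 2 <= k ^+ 2) -> op_norm T <= k.
Proof.
move=> k0 Tal alk.
have al0 x : 0 <= al x by exact: le_trans (Tal x).
have Tfin (f : ell2 R X) A : `|T (fin_vec f A)| <= k * `|f|.
  rewrite /fin_vec linear_sum; apply: le_trans (ler_norm_sum _ _ _) _.
  apply: (@le_trans _ _ (\sum_(x <- A) `|f x| * al x)).
    by apply: ler_sum => x _; rewrite linearZ /= normrZ ler_wpM2l //; exact: Tal.
  rewrite -ler_sqr ?nnegrE ?mulr_ge0 ?sumr_ge0//; last by move=> x _; rewrite mulr_ge0.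
  apply: le_trans (sum_CauchySchwarz _ _ _) _ => //.
  rewrite exprMn mulrC; apply: ler_pM.
  - by rewrite sumr_ge0// => x _; rewrite exprn_ge0.
  - by rewrite sumr_ge0// => x _; rewrite exprn_ge0.
  - exact: alk.
  - by rewrite -partial_sumE ell2_norm_ge.
apply: op_norm_le => f f1; apply/ler_addgt0Pr => e e0.
have T1 : 0 < op_norm T + 1 by rewrite ltr_wpDl// op_norm_ge0.
have [A fA] : exists A, `|f - fin_vec f A| < e / (op_norm T + 1).
  by apply: fin_vec_approx; rewrite divr_gt0.
rewrite -(subrK (fin_vec f A) f) linearD addrC; apply: le_trans (ler_normD _ _) _.
apply: lerD; first by apply: le_trans (Tfin f A) _; rewrite ler_piMr.
apply: le_trans (op_norm_le_mul _ _) _.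
apply: (@le_trans _ _ ((op_norm T + 1) * `|f - fin_vec f A|)).
  by rewrite ler_wpM2r// lerDl.
by rewrite mulrC -ler_pdivlMr// ltW.
Qed.

Lemma op_adjoint (H : hilbertType R) (T : bounded_op H) k :
  exists z, forall h, inner (T h) k = inner h z.
Proof.
have [|h|z hz] := @riesz _ _ (fun h => inner (T h) k) (op_norm T * `|k|).
- by move=> a x y; rewrite linearP linearPl.
- by rewrite mulrAC; exact: op_inner_le.
by exists z.
Qed.

End OperatorBounds.

Section Wot.
Context {R : realType} {H : hilbertType R}.
Local Notation C := R[i].
Implicit Types (A : set (bounded_op H)) (S T : bounded_op H).

(** For the nontrivial direction, the sets of those S in A that approximate T on a given
    finite list up to a given error form a filter converging weakly to T. *)
Lemma wot_closureP A T : wot_closure A T <->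
  forall (s : seq (H * H)) (e : C), 0 < e ->
    exists2 S, A S & forall p, p \in s -> `|inner (S p.1) p.2 - inner (T p.1) p.2| < e.
Proof.
pose c (S : wot H) : {ptws H * H -> C} := fun p => inner ((S : bounded_op H) p.1) p.2.
have proj_c (p : H * H) : continuous (fun S : wot H => c S p).
  move=> S; have cS : {ptws, c @ S --> c S} by exact: initial_continuous.
  have := (@pointwise_cvgP (H * H)%type C (c @ nbhs S) (c S) _).1 cS p; exact.
split=> [clT s e e0|hT].
  have : nbhs (T : wot H) [set S : wot H | forall p, p \in s -> `|c S p - c T p| < e].
    elim: s => [|q s ih]; first by apply: filterE => S p.
    have nq : nbhs (T : wot H) [set S : wot H | `|c S q - c T q| < e].
      have /cvgrPdist_lt/(_ e e0) := proj_c q (T : wot H).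
      by apply: filterS => S /=; rewrite distrC.
    apply: filterS (filterI nq ih) => S [Sq Ss] p.
    by rewrite inE => /predU1P[->|]; [exact: Sq|exact: Ss].
  by move=> /clT[S [AS hS]]; exists S.
pose B (se : seq (H * H) * R) : set (wot H) :=
  [set S | A S /\ forall p, p \in se.1 -> `|c S p - c T p| < (se.2)%:C].
pose F := filter_from [set se : seq (H * H) * R | 0 < se.2] B.
have FF : ProperFilter F.
  apply: filter_from_proper => [|[s e] /= e0]; last first.
    have e0' : 0 < e%:C by rewrite ltcR.
    by have [S AS hS] := hT s e%:C e0'; exists S.
  apply: filter_from_filter; first by exists ([::], 1) => /=.
  move=> [s1 e1] [s2 e2] /= e10 e20; exists (s1 ++ s2, Num.min e1 e2).
    by rewrite /= lt_min e10.
  move=> S [AS hS]; split; split=> // p ps.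
    by apply: (lt_le_trans (hS p _)); rewrite ?mem_cat ?ps// lecR ge_min lexx.
  by apply: (lt_le_trans (hS p _)); rewrite ?mem_cat ?ps ?orbT// lecR ge_min lexx orbT.
have cF : c @ F --> c T.
  apply/pointwise_cvgP => p; apply/cvgrPdist_lt => e e0.
  exists ([:: p], complex.Re e); first by rewrite /= -ltcR gt0_Re.
  by move=> S [_ /(_ p)] /=; rewrite mem_head gt0_Re// distrC; apply.
move=> P; rewrite nbhsE => -[_ [[D Dop <-] DT] sDP].
have FD : F (c @^-1` D) by apply: cF; exact: open_nbhs_nbhs.
have FA : F A by exists ([::], 1) => //= S [].
by have [S [AS DS]] := filter_ex (filterI FA FD); exists S; split=> //; exact: sDP.
Qed.

Lemma subset_wot_closure A : A `<=` wot_closure A.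
Proof. by move=> T AT; apply/wot_closureP => s e e0; exists T => // p _; rewrite subrr normr0. Qed.

Lemma wot_closure_idem A T : wot_closure (wot_closure A) T -> wot_closure A T.
Proof.
move=> /wot_closureP hT; apply/wot_closureP => s e e0.
have e20 : 0 < e / 2 by rewrite divr_gt0.
have [S /wot_closureP hS ST] := hT s _ e20; have [U AU US] := hS s _ e20.
exists U => // p ps; rewrite (splitr e) (le_lt_trans (ler_distD (inner (S p.1) p.2) _ _))//.
by rewrite ltrD ?US ?ST.
Qed.

Lemma wot_closureD A : (forall S T, A S -> A T -> A (S + T)) ->
  forall S T, wot_closure A S -> wot_closure A T -> wot_closure A (S + T).
Proof.
move=> AD S T /wot_closureP hS /wot_closureP hT; apply/wot_closureP => s e e0.
have e20 : 0 < e / 2 by rewrite divr_gt0.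
have [S' AS SS] := hS s _ e20; have [T' AT TT] := hT s _ e20.
exists (S' + T'); first exact: AD.
move=> p ps; rewrite (splitr e).
rewrite -[(S' + T') _]/(S' p.1 + T' p.1) -[(S + T) _]/(S p.1 + T p.1) !linearDl.
by rewrite opprD addrACA (le_lt_trans (ler_normD _ _))// ltrD ?SS ?TT.
Qed.

Lemma wot_closureZ A : (forall (a : C) T, A T -> A (a *: T)) ->
  forall (a : C) T, wot_closure A T -> wot_closure A (a *: T).
Proof.
move=> AZ a T /wot_closureP hT; apply/wot_closureP => s e e0.
have a0 : 0 < `|a| + 1 by rewrite ltr_wpDl.
have e20 : 0 < e / (`|a| + 1) by rewrite divr_gt0.
have [T' AT TT] := hT s _ e20; exists (a *: T'); first exact: AZ.
move=> p ps; rewrite -[(a *: T') _]/(a *: T' p.1) -[(a *: T) _]/(a *: T p.1).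
rewrite !linearZl_LR /= -mulrBr normrM.
apply: (@le_lt_trans _ _ ((`|a| + 1) * `|inner (T' p.1) p.2 - inner (T p.1) p.2|)).
  by rewrite ler_wpM2r// lerDl.
by rewrite mulrC -ltr_pdivlMr// TT.
Qed.

Lemma wot_closure_norm A T :
  (forall e : C, 0 < e -> exists2 S, A S & op_norm (S - T) <= e) -> wot_closure A T.
Proof.
move=> hT; apply/wot_closureP => s e e0.
(* adding 1 keeps m nonzero when all the pairs vanish *)
pose m := 1 + \sum_(p <- s) `|p.1| * `|p.2|.
have m0 : 0 < m by rewrite ltr_pwDl// sumr_ge0// => p _; rewrite mulr_ge0.
have em0 : 0 < e / m / 2 by rewrite !divr_gt0.
have [S AS ST] := hT _ em0; exists S => // p ps.
rewrite -linearBl -[S p.1 - T p.1]/((S - T) p.1).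
apply: le_lt_trans (op_inner_le _ _ _) _.
rewrite -mulrA; have pm : `|p.1| * `|p.2| <= m.
  rewrite /m (big_rem p)//= addrCA lerDl addr_ge0//.
  by apply: sumr_ge0 => q _; rewrite mulr_ge0.
apply: (@le_lt_trans _ _ (e / m / 2 * m)).
  by apply: ler_pM; rewrite ?op_norm_ge0 ?mulr_ge0.
by rewrite mulrAC divfK ?lt0r_neq0// ltr_pdivrMr// ltr_pMr// ltr1n.
Qed.

Lemma wot_closure_coef (A : set (bounded_op H)) (f k f' k' : H) (a : C) :
  (forall S, A S -> inner (S f) k = a * inner (S f') k') ->
  forall T, wot_closure A T -> inner (T f) k = a * inner (T f') k'.
Proof.
move=> hA T /wot_closureP hT; apply/eqP; rewrite -subr_eq0 -normr_le0.
apply/ler_addgt0Pr => e e0; rewrite add0r.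
have a0 : 0 < 1 + `|a| by rewrite ltr_pwDl.
have ea0 : 0 < e / (1 + `|a|) by rewrite divr_gt0.
have [S AS ST] := hT [:: (f, k); (f', k')] _ ea0.
have := ST (f, k); have := ST (f', k'); rewrite !inE !eqxx orbT /= (hA S AS).
move=> /(_ isT) S2 /(_ isT) S1.
have -> : inner (T f) k - a * inner (T f') k' =
    a * (inner (S f') k' - inner (T f') k') - (a * inner (S f') k' - inner (T f) k).
  ring.
apply: le_trans (ler_normB _ _) _; rewrite normrM.
have -> : e = `|a| * (e / (1 + `|a|)) + e / (1 + `|a|).
  by field; exact: lt0r_neq0.
by rewrite lerD ?(ltW S1)// ler_wpM2l// ltW.
Qed.

Lemma wot_closure_comp_r (A B : set (bounded_op H)) (U : bounded_op H) :
  (forall S, A S -> B (op_comp S U)) ->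
  forall T, wot_closure A T -> wot_closure B (op_comp T U).
Proof.
move=> AB T /wot_closureP hT; apply/wot_closureP => s e e0.
have [S AS ST] := hT [seq (U q.1, q.2) | q <- s] e e0.
exists (op_comp S U); first exact: AB.
by move=> q qs; apply: (ST (U q.1, q.2)); exact: (map_f (fun q => (U q.1, q.2))).
Qed.

(** Composition on the left is weakly continuous because it is a composition on the right
    for the adjoint. *)
Lemma wot_closure_comp_l (A B : set (bounded_op H)) (U : bounded_op H) :
  (forall S, A S -> B (op_comp U S)) ->
  forall T, wot_closure A T -> wot_closure B (op_comp U T).
Proof.
move=> AB T /wot_closureP hT; apply/wot_closureP => s e e0.
have [adj adjP] := choice (op_adjoint U).
have [S AS ST] := hT [seq (q.1, adj q.2) | q <- s] e e0.
exists (op_comp U S); first exact: AB.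
move=> q qs; rewrite !op_compE !adjP.
by apply: (ST (q.1, adj q.2)); exact: (map_f (fun q => (q.1, adj q.2))).
Qed.

Lemma coef0 (f k f' k' : H) (a : C) :
  inner ((0 : bounded_op H) f) k = a * inner ((0 : bounded_op H) f') k'.
Proof. by rewrite !op0E !inner0l mulr0. Qed.

Lemma coefD (f k f' k' : H) (a : C) (S T : bounded_op H) :
  inner (S f) k = a * inner (S f') k' -> inner (T f) k = a * inner (T f') k' ->
  inner ((S + T) f) k = a * inner ((S + T) f') k'.
Proof. by move=> hS hT; rewrite !opDE !innerDl hS hT mulrDr. Qed.

Lemma coefZ (f k f' k' : H) (a b : C) (T : bounded_op H) :
  inner (T f) k = a * inner (T f') k' ->
  inner ((b *: T) f) k = a * inner ((b *: T) f') k'.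
Proof. by move=> hT; rewrite !opZE !innerZl hT mulrCA. Qed.

Definition rank1_fun (g h : H) (u : H) := inner u g *: h.

Lemma rank1_subproof g h : rank1_fun g h \in bounded_op_pred.
Proof.
have rl : linear (rank1_fun g h).
  by move=> a u v; rewrite /rank1_fun linearPl /= scalerDl scalerA.
apply/asboolP; split => //.
pose f : {linear H -> H} := HB.pack (rank1_fun g h) (GRing.isLinear.Build _ _ _ _ _ rl).
apply: (@bounded_linear_continuous _ _ _ f (`|g| * `|h|)); first by rewrite mulr_ge0.
move=> u; rewrite /= /rank1_fun normrZ mulrAC ler_wpM2r// mulrC.
exact: norm_inner_le.
Qed.

Definition rank1 g h : bounded_op H := BoundedOp (rank1_subproof g h).

Lemma rank1E (g h u : H) : rank1 g h u = inner u g *: h.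
Proof. by []. Qed.

End Wot.

Section MatrixUnits.
Context {R : realType} {X : choiceType}.
Local Notation C := R[i].
Local Notation H := (ell2 R X).
Local Notation basis := (@ell2_basis R X).

(** The compression P T P of T to the coordinates in A, written with the matrix units
    [rank1 (basis x) (basis y)]. *)
Definition corner (T : bounded_op H) (A : {fset X}) : bounded_op H :=
  \sum_(x <- A) \sum_(y <- A) inner (T (basis x)) (basis y) *: rank1 (basis x) (basis y).

Lemma corner_inner T A (h k : H) :
  inner (corner T A h) k = inner (T (fin_vec h A)) (fin_vec k A).
Proof.
have -> : T (fin_vec h A) = \sum_(x <- A) h x *: T (basis x).
  by rewrite linear_sum; apply: eq_bigr => x _; rewrite linearZ.
rewrite /corner op_sumE !inner_suml; apply: eq_bigr => x _.
rewrite op_sumE inner_suml inner_sumr; apply: eq_bigr => y _.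
rewrite opZE rank1E !innerZl innerZr inner_basisl (ell2_inner_basis h).
by rewrite mulrCA [_ * inner _ _]mulrC.
Qed.

Lemma corner_near T (h k : H) (e : C) : 0 < e ->
  \forall A \near totally, `|inner (corner T A h) k - inner (T h) k| < e.
Proof.
move=> e0.
pose m := op_norm T * (`|h| + `|k|) + 1.
have m0 : 0 < m by rewrite ltr_wpDl// mulr_ge0 ?op_norm_ge0 ?addr_ge0.
have em0 : 0 < e / m by rewrite divr_gt0.
apply: filterS (filterI (fin_vec_near h em0) (fin_vec_near k em0)) => A [hA kA].
rewrite corner_inner.
have -> : inner (T (fin_vec h A)) (fin_vec k A) - inner (T h) k =
   - (inner (T (h - fin_vec h A)) (fin_vec k A) + inner (T h) (k - fin_vec k A)).
  rewrite linearB innerBl.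
  have -> : inner (T h) (k - fin_vec k A) = inner (T h) k - inner (T h) (fin_vec k A).
    exact: linearBr.
  ring.
rewrite normrN; apply: le_lt_trans (ler_normD _ _) _.
apply: (@le_lt_trans _ _ (op_norm T * (`|h| + `|k|) * (e / m))).
  rewrite mulrDr mulrDl addrC; apply: lerD; apply: le_trans (op_inner_le _ _ _) _.
    by rewrite ler_wpM2l ?mulr_ge0 ?op_norm_ge0// ltW.
  rewrite -!mulrA ler_wpM2l ?op_norm_ge0// mulrC.
  by apply: ler_pM => //; [exact: fin_vec_norm_le|exact: ltW].
by rewrite mulrCA -[ltRHS]mulr1 ltr_pM2l// ltr_pdivrMr// mul1r /m ltrDl.
Qed.

(** Every T is the weak limit of its corners, which are combinations of matrix units. *)
Lemma wot_closure_matrix_units (A : set (bounded_op H)) :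
  A 0 -> (forall S T, A S -> A T -> A (S + T)) ->
  (forall (a : C) T, A T -> A (a *: T)) ->
  (forall x y, wot_closure A (rank1 (basis x) (basis y))) ->
  wot_closure A = [set: bounded_op H].
Proof.
move=> A0 AD AZ AE; apply/seteqP; split=> // T _.
have cA0 : wot_closure A 0 by exact: subset_wot_closure.
have cAsum (I : Type) (r : seq I) (F : I -> bounded_op H) :
    (forall i, wot_closure A (F i)) -> wot_closure A (\sum_(i <- r) F i).
  move=> hF; elim: r => [|i r ih]; first by rewrite big_nil.
  by rewrite big_cons; apply: wot_closureD.
apply: wot_closure_idem; apply/wot_closureP => s e e0.
have : \forall B \near totally, forall p : H * H, p \in s ->
    `|inner (corner T B p.1) p.2 - inner (T p.1) p.2| < e.
  elim: s => [|q s ih]; first by apply: filterE.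
  apply: filterS (filterI (corner_near T q.1 q.2 e0) ih) => B [Bq Bs] p.
  by rewrite inE => /predU1P[->|/Bs].
move=> /filter_ex[B hB]; exists (corner T B) => //.
by apply: (cAsum _ _ _ _) => x; apply: (cAsum _ _ _ _) => y; apply: wot_closureZ.
Qed.

End MatrixUnits.

(** * Paths *)

Section PathAlgebra.
Context {G : digraph}.
Implicit Types (p q w : gpath G).

Lemma gpathP (p : gpath G) : is_path (psrc p) (pedges p).
Proof. by case: p. Qed.

Lemma psrc_pmul p q : psrc p = prng q -> psrc (pmul p q) = psrc q.
Proof. by move=> pq; rewrite /psrc val_pmul. Qed.

Lemma pedges_pmul p q : psrc p = prng q -> pedges (pmul p q) = pedges q ++ pedges p.
Proof. by move=> pq; rewrite /pedges val_pmul. Qed.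

Lemma path_end_cat (x : vertex G) s t :
  path_end x (s ++ t) = path_end (path_end x s) t.
Proof. by rewrite /path_end map_cat last_cat. Qed.

Lemma prng_pmul p q : psrc p = prng q -> prng (pmul p q) = prng p.
Proof.
move=> pq; rewrite /prng psrc_pmul// pedges_pmul// path_end_cat.
by rewrite -[path_end _ (pedges q)]/(prng q) -pq.
Qed.

Lemma gpath_eq p q : psrc p = psrc q -> pedges p = pedges q -> p = q.
Proof.
rewrite /psrc /pedges => s e; apply: val_inj.
by rewrite [val p]surjective_pairing [val q]surjective_pairing s e.
Qed.

Lemma pmulA p q w : psrc p = prng q -> psrc q = prng w ->
  pmul p (pmul q w) = pmul (pmul p q) w.
Proof.
move=> pq qw.
have pqw : psrc p = prng (pmul q w) by rewrite prng_pmul.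
have pqw' : psrc (pmul p q) = prng w by rewrite psrc_pmul.
by apply: gpath_eq; rewrite ?psrc_pmul ?pedges_pmul// catA.
Qed.

Lemma pmul_pvertex p x : psrc p = x -> pmul p (pvertex x) = p.
Proof. by move=> px; apply: gpath_eq; rewrite ?psrc_pmul ?pedges_pmul. Qed.

Lemma pvertex_pmul p x : prng p = x -> pmul (pvertex x) p = p.
Proof. by move=> px; apply: gpath_eq; rewrite ?psrc_pmul ?pedges_pmul ?cats0. Qed.

Lemma pmul_cancelr (p q w : gpath G) : psrc p = prng w -> psrc q = prng w ->
  pmul p w = pmul q w -> p = q.
Proof.
move=> pw qw e; apply: gpath_eq; first by rewrite pw qw.
have := congr1 (@pedges G) e; rewrite !pedges_pmul// => /eqP.
by rewrite eqseq_cat// eqxx => /eqP.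
Qed.

End PathAlgebra.

Section OutDegreeOne.
Context {G : digraph}.
Local Notation V := (vertex G).
Local Notation E := (edge G).
Hypothesis out_uniq : forall e e' : E, edge_src e = edge_src e' -> e = e'.
Variable out : V -> E.
Hypothesis outP : forall x, edge_src (out x) = x.

Definition next (x : V) : V := edge_rng (out x).

Lemma path_edges_uniq (x : V) s t : is_path x s -> is_path x t -> size s = size t -> s = t.
Proof.
elim: s t x => [|e s ih] [|e' t] x //= /andP[/eqP ex ps] /andP[/eqP ex' pt] [st].
have ee : e = e' by apply: out_uniq; rewrite ex ex'.
by rewrite -ee in pt *; rewrite (ih t (edge_rng e)).
Qed.

Lemma path_end_next (x : V) s : is_path x s -> path_end x s = iter (size s) next x.
Proof.
elim: s x => //= e s ih x /andP[/eqP ex ps].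
have -> : path_end x (e :: s) = path_end (edge_rng e) s by [].
rewrite ih// -iterS iterSr; congr iter; rewrite /next; congr edge_rng.
by apply: out_uniq; rewrite outP.
Qed.

Lemma out_path_exists k (x : V) : exists2 s, is_path x s & size s = k.
Proof.
elim: k x => [|k ih] x; first by exists [::].
have [s ps sk] := ih (next x); exists (out x :: s) => /=; last by rewrite sk.
by rewrite outP eqxx.
Qed.

(** All vertices lie on the orbit of x0 under [next], and [next] permutes that orbit
    cyclically; its length is the smallest period of x0. *)
Lemma periodic_vertex_cycle (x0 : V) n : (0 < n)%N -> iter n next x0 = x0 ->
  (forall y, exists k, y = iter k next x0) -> cycle_graph G.
Proof.
move=> n0 nx reach.
have ex : exists m, (0 < m)%N && (iter m next x0 == x0) by exists n; rewrite n0 nx eqxx.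
case: (ex_minnP ex) => m /andP[m0 /eqP mx] mmin {n n0 nx ex}.
have iter_mul q : iter (q * m) next x0 = x0.
  by elim: q => // q ih; rewrite mulSn iterD ih.
have iter_mod k : iter k next x0 = iter (k %% m) next x0.
  by rewrite {1}(divn_eq k m) addnC iterD iter_mul.
pose f (i : 'I_m) := iter i next x0.
have f_lt (i j : nat) : (i < j < m)%N -> iter i next x0 <> iter j next x0.
  move=> /andP[ij jm] fij; have := mmin ((m - j) + i)%N.
  rewrite iterD fij -iterD subnK ?(ltnW jm)// mx eqxx andbT addn_gt0 subn_gt0 jm.
  move=> /(_ isT); lia.
have f_inj : injective f.
  move=> i j fij; apply: val_inj => /=; case: (ltngtP i j) => // ij.
    by case: (f_lt i j); rewrite ?ij ?ltn_ord.
  by case: (f_lt j i); rewrite ?ij ?ltn_ord.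
have f_surj y : exists i, f i = y.
  have [k ->] := reach y; exists (Ordinal (ltn_pmod k m0)).
  by rewrite /f /= -iter_mod.
have [g fg] := choice f_surj.
have gf : cancel f g by move=> i; apply: f_inj; rewrite fg.
exists m; split=> //; exists f, (fun i => out (f i)); split.
- by exists g.
- exists (fun e => g (edge_src e)) => [i|e]; first by rewrite outP gf.
  by apply: out_uniq; rewrite outP fg.
- by move=> i; rewrite outP.
- by move=> i; rewrite -[LHS]/(iter i.+1 next x0) iter_mod.
Qed.

End OutDegreeOne.

Section GraphLemmas.
Context {G : digraph}.
Local Notation V := (vertex G).
Local Notation E := (edge G).

(** In a cycle graph a path is determined by its source and its length, so two closed paths
    at the same vertex commute. *)
Lemma cycle_graph_cycle : cycle_graph G -> exists (x : V) (c : gpath G),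
  [/\ psrc c = x, prng c = x, c != pvertex x &
      forall p, psrc p = x -> prng p = x -> pmul c p = pmul p c].
Proof.
case=> n [n0 [x [e [xb eb srce rnge]]]].
have [xi xK Kx] := xb; have [ei eK Ke] := eb.
have out_uniq (a b : E) : edge_src a = edge_src b -> a = b.
  rewrite -(Ke a) -(Ke b) !srce => ab.
  by rewrite (bij_inj xb ab).
pose out v := e (xi v).
have outP v : edge_src (out v) = v by rewrite srce Kx.
pose i0 := Ordinal n0; pose v := x i0.
have nextx i : next out (x i) = x (ordS i) by rewrite /next /out xK rnge.
have iterx k : iter k (next out) v = x (iter k (@ordS n) i0).
  by elim: k => // k ih; rewrite !iterS ih nextx.
have iterv k : iter k (@ordS n) i0 = (k %% n)%N :> nat.
  elim: k => [|k ih]; first by rewrite /= mod0n.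
  by rewrite iterS /= ih -addn1 modnDml addn1.
(* [c] goes once around the cycle. *)
have [s ps sn] := out_path_exists outP n v.
pose c := @GPath G (v, s) ps.
have rc : prng c = v.
  rewrite /prng (path_end_next out_uniq outP)//= sn iterx; congr x.
  by apply: val_inj; rewrite /= iterv modnn.
exists v, c; split=> //.
  apply/eqP => /(congr1 (fun p => size (pedges p))) /=.
  by rewrite sn => n00; move: (n0); rewrite n00.
move=> p sp rp.
have cp : psrc c = prng p by rewrite rp.
have pc : psrc p = prng c by rewrite rc.
apply: gpath_eq; first by rewrite !psrc_pmul.
apply: (path_edges_uniq out_uniq (x := v)).
- by have := gpathP (pmul c p); rewrite psrc_pmul// sp.
- by have := gpathP (pmul p c); rewrite psrc_pmul.
- by rewrite !pedges_pmul// !size_cat addnC.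
Qed.

(** If no two edges had a common source, every vertex would have exactly one outgoing edge;
    following these edges from x0 reaches every vertex and returns to x0. *)
Lemma branching_vertex (x0 : V) : strongly_transitive G ->
  exists e1 e2 : E, e1 != e2 /\ edge_src e1 = edge_src e2.
Proof.
move=> [ntriv trans ncyc]; apply: contrapT => hN.
have out_uniq (a b : E) : edge_src a = edge_src b -> a = b.
  by move=> ab; apply/eqP/negPn/negP => neq; apply: hN; exists a, b.
have out_ex x : exists e : E, edge_src e = x.
  have [[y yx]|allx] := pselect (exists y, y != x).
    have [p [sp rp]] : exists p : gpath G, psrc p = x /\ prng p = y.
      by apply: trans; rewrite eq_sym.
    have := gpathP p; rewrite sp; case pe : (pedges p) => [|e s] /=.
      by move: rp; rewrite /prng pe /path_end /= sp => xy; rewrite xy eqxx in yx.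
    by case/andP => /eqP ex _; exists e.
  have {}allx y : y = x by apply/eqP/negPn/negP => yx; apply: allx; exists y.
  apply: contrapT => noe; apply: ntriv; split; first by exists x.
  by move=> e; apply: noe; exists e.
have [out outP] := choice out_ex.
apply: ncyc.
have reach x y : exists k, y = iter k (next out) x.
  have [->|xy] := eqVneq x y; first by exists 0%N.
  have [p [sp rp]] := trans x y xy; exists (size (pedges p)).
  rewrite -(path_end_next out_uniq outP) -sp; last exact: gpathP.
  by rewrite -rp.
have [k kx] := reach (next out x0) x0.
apply: (periodic_vertex_cycle out_uniq outP (x0 := x0) (n := k.+1)) => //.
by rewrite iterSr -kx.
Qed.

Lemma first_visit (b v : vertex G) s : is_path v s -> path_end v s = b ->
  exists s', [/\ is_path v s', path_end v s' = b & all (fun e => edge_src e != b) s'].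
Proof.
elim: s v => [|e s ih] v; first by exists [::].
move=> /= /andP[/eqP ev ps] pe; have [->|vb] := eqVneq v b; first by exists [::].
have [s' [ps' pe' fs']] := ih _ ps pe.
by exists (e :: s'); split=> //=; rewrite ?ev ?eqxx ?vb.
Qed.

Lemma transitive_first_visit (b : vertex G) : transitive_graph G -> exists h,
  forall v, [/\ is_path v (h v), path_end v (h v) = b & all (fun e => edge_src e != b) (h v)].
Proof.
move=> trans; suff H v : exists s, [/\ is_path v s, path_end v s = b &
    all (fun e => edge_src e != b) s] by have [h hP] := choice H; exists h.
have [->|vb] := eqVneq v b; first by exists [::].
have [p [pv pb]] := trans _ _ vb.
apply: (@first_visit b v (pedges p)); first by rewrite -pv gpathP.
by rewrite -pv.
Qed.

End GraphLemmas.

(** * Elements of the free semigroupoid algebra *)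

Section Fsa.
Context {R : realType} {G : digraph}.
Local Notation C := R[i].
Local Notation K := (ell2 R (gpath G)).
Local Notation fsa := (free_semigroupoid_algebra R G).
Local Notation L := (@creation R G).
Implicit Types (p q w : gpath G) (A B : bounded_op K).

Lemma creation_vertex p x : psrc p = x -> L p (ell2_basis (pvertex x)) = ell2_basis p.
Proof. by move=> px; rewrite creation_basis px eqxx pmul_pvertex. Qed.

Lemma creation_neq0 p : L p != 0.
Proof.
apply/eqP => Lp; have /eqP := creation_vertex (erefl (psrc p)).
by rewrite Lp op0E eq_sym (negPf (ell2_basis_neq0 p)).
Qed.

Lemma creation_comp p q :
  op_comp (L p) (L q) = if psrc p == prng q then L (pmul p q) else 0.
Proof.
apply: op_ext_basis => w; rewrite op_compE creation_basis.
have [qw|qw] := eqVneq (psrc q) (prng w); last first.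
  rewrite linear0; case: eqVneq => // pq.
  by rewrite creation_basis psrc_pmul// (negPf qw).
rewrite creation_basis prng_pmul//; case: eqVneq => // pq.
by rewrite creation_basis psrc_pmul// qw eqxx pmulA.
Qed.

(** The linear span of the creation operators is closed under composition, so it is the
    algebra that they generate. *)
Lemma creation_linear_ind (P : bounded_op (ell2 R (gpath G)) -> Prop) :
  P 0 -> (forall A B, P A -> P B -> P (A + B)) ->
  (forall (a : C) A, P A -> P (a *: A)) -> (forall p, P (L p)) ->
  forall A, smallest (@is_subalgebra R _) (range L) A -> P A.
Proof.
move=> P0 PD PZ PL.
pose lin (Q : set (bounded_op (ell2 R (gpath G)))) :=
  [/\ Q 0, forall A B, Q A -> Q B -> Q (A + B) &
      forall (a : C) A, Q A -> Q (a *: A)].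
pose span := smallest lin (range L).
have lspan : lin span.
  split=> [Q [] []//|A B sA sB Q QQ|a A sA Q QQ]; have [[Q0 QD QZ] QL] := QQ.
  - by apply: QD; [apply: sA|apply: sB].
  - by apply: QZ; apply: sA.
have [s0 sD sZ] := lspan.
have sL p : span (L p) by move=> Q [_]; apply; exists p.
have sLM p A : span A -> span (op_comp (L p) A).
  move=> sA; apply: (sA [set A | span (op_comp (L p) A)]); split.
    split=> [|A1 A2 /= h1 h2|a A1 /= h1].
    - rewrite /= (_ : op_comp _ _ = 0)//; apply: op_ext => h.
      by rewrite op_compE linear0.
    - rewrite (_ : op_comp _ _ = op_comp (L p) A1 + op_comp (L p) A2); first exact: sD.
      by apply: op_ext => h; rewrite op_compE linearD.
    - rewrite (_ : op_comp _ _ = a *: op_comp (L p) A1); first exact: sZ.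
      by apply: op_ext => h; rewrite op_compE linearZ.
  move=> _ [q _ <-] /=; rewrite creation_comp; case: ifP => // _; exact: sL.
have sM A B : span A -> span B -> span (op_comp A B).
  move=> sA sB; apply: (sA [set A | span (op_comp A B)]); split.
    split=> [|A1 A2 /= h1 h2|a A1 /= h1].
    - by rewrite /= (_ : op_comp _ _ = 0)//; apply: op_ext => h.
    - rewrite (_ : op_comp _ _ = op_comp A1 B + op_comp A2 B); first exact: sD.
      by apply: op_ext => h.
    - rewrite (_ : op_comp _ _ = a *: op_comp A1 B); first exact: sZ.
      by apply: op_ext => h.
  by move=> _ [p _ <-] /=; apply: sLM.
move=> A /(_ span) sA; have /sA {}sA : is_subalgebra span /\ range L `<=` span.
  by split=> [|_ [p _ <-]]; [split|exact: sL].
apply: (sA P); split; first by split.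
by move=> _ [p _ <-].
Qed.

(** Linear relations between two matrix coefficients hold on the whole algebra as soon as they
    hold for creation operators.  All identities in the algebra are proved in this way. *)
Lemma fsa_coef (f k f' k' : ell2 R (gpath G)) (a : C) :
  (forall p, inner (L p f) k = a * inner (L p f') k') ->
  forall A, fsa A -> inner (A f) k = a * inner (A f') k'.
Proof.
move=> hL; apply: wot_closure_coef; apply: creation_linear_ind => //.
- exact: coef0.
- by move=> A B; exact: coefD.
- by move=> b A; exact: coefZ.
Qed.

Lemma fsa_coef_eq0 (f k : K) : (forall p, inner (L p f) k = 0) ->
  forall A, fsa A -> inner (A f) k = 0.
Proof.
move=> h A fA; rewrite -[RHS](mul0r (inner (A f) k)).
by apply: fsa_coef fA => p; rewrite mul0r.
Qed.

(** Elements of the algebra commute with right multiplication by a path w, so that the value at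
    xi_w is determined by the value at the vertex where w ends. *)
Lemma fsa_eq0 A : fsa A -> (forall v, A (ell2_basis (pvertex v)) = 0) -> A = 0.
Proof.
move=> fA hA; apply: op_ext_basis => w; apply: ell2_eq => u; rewrite op0E.
rewrite -[LHS]ell2_inner_basis.
have [[u' [su uE]]|noq] := pselect (exists u', psrc u' = prng w /\ u = pmul u' w).
  rewrite (_ : inner _ _ = 1 * inner (A (ell2_basis (pvertex (prng w)))) (ell2_basis u')).
    by rewrite hA inner0l mulr0.
  apply: fsa_coef fA => p; rewrite mul1r !ell2_inner_basis.
  have [pw|pw] := eqVneq (psrc p) (prng w); last first.
    have pv : (psrc p == prng (pvertex (prng w))) = false by exact: negPf pw.
    by rewrite !creation_basis !pv.
  rewrite (creation_vertex pw) creation_basis pw eqxx !ell2_basisE uE.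
  congr (_%:R); congr nat_of_bool.
  by apply/eqP/eqP => [|->//]; exact: pmul_cancelr.
apply: fsa_coef_eq0 fA => p; rewrite ell2_inner_basis creation_basis.
case: eqP => // pw; rewrite ell2_basisE; case: eqP => // uE.
by case: noq; exists p.
Qed.

Let algP : is_subalgebra (smallest (@is_subalgebra R _) (range L)).
Proof.
split=> [Q [] []//|S T sS sT Q QQ|a T sT Q QQ|S T sS sT Q QQ]; have [[Q0 QD QZ QM] QL] := QQ.
- by apply: QD; [apply: sS|apply: sT].
- by apply: QZ; apply: sT.
- by apply: QM; [apply: sS|apply: sT].
Qed.

Lemma fsa0 : fsa 0.
Proof. by have [a0 _ _ _] := algP; exact: subset_wot_closure. Qed.

Lemma fsaD A B : fsa A -> fsa B -> fsa (A + B).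
Proof. by have [_ aD _ _] := algP; exact: wot_closureD. Qed.

Lemma fsaZ (a : C) A : fsa A -> fsa (a *: A).
Proof. by have [_ _ aZ _] := algP; exact: wot_closureZ. Qed.

Lemma fsa_creation p : fsa (L p).
Proof. by apply: subset_wot_closure => Q [_]; apply; exists p. Qed.

Lemma fsa_comp_creation A p : fsa A -> fsa (op_comp A (L p)).
Proof.
apply: wot_closure_comp_r => S sS; have [_ _ _ aM] := algP.
by apply: aM => // Q [_]; apply; exists p.
Qed.

Lemma fsa_creation_comp A p : fsa A -> fsa (op_comp (L p) A).
Proof.
apply: wot_closure_comp_l => S sS; have [_ _ _ aM] := algP.
by apply: aM => // Q [_]; apply; exists p.
Qed.

End Fsa.

Arguments fsa_creation {R G} p.
Arguments fsa0 {R G}.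
Arguments fsaZ {R G} a {A} _.

(** * Graphs with a faithful irreducible representation *)

Section Necessity.
Context {R : realType} {G : digraph} {H : hilbertType R}.
Local Notation C := R[i].
Local Notation K := (ell2 R (gpath G)).
Local Notation fsa := (free_semigroupoid_algebra R G).
Local Notation L := (@creation R G).
Variable rho : bounded_op K -> bounded_op H.
Hypothesis rhoP : representation fsa rho.
Hypothesis rho_inj : faithful fsa rho.
Hypothesis rho_irr : irreducible fsa rho.
Implicit Types (p q w : gpath G).

(** Two weak limits are taken, the first in the algebra and the second in the closure of its
    image.  Each time adjoints turn the outer factors into vectors. *)
Lemma rep_relation (a b c d : gpath G) (z : C) :
  (forall p, op_comp (L a) (op_comp (L p) (L b)) =
             z *: op_comp (L c) (op_comp (L p) (L d))) ->
  forall (T : bounded_op H) h,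
    rho (L a) (T (rho (L b) h)) = z *: rho (L c) (T (rho (L d) h)).
Proof.
move=> hL; have [rhoD rhoZ rhoM _] := rhoP.
have hA A : fsa A -> op_comp (L a) (op_comp A (L b)) =
             z *: op_comp (L c) (op_comp A (L d)).
  move=> fA; apply: op_ext_basis => w; apply: ell2_eq => u.
  rewrite -!(@ell2_inner_basis R).
  have [k1 hk1] := op_adjoint (L a) (ell2_basis u).
  have [k2 hk2] := op_adjoint (L c) (ell2_basis u).
  rewrite opZE !op_compE innerZl hk1 hk2.
  apply: fsa_coef fA => p; rewrite -hk1 -hk2 -innerZl.
  by have := congr1 (fun T : bounded_op K => T (ell2_basis w)) (hL p) => /= ->.
have hrho A : fsa A -> op_comp (rho (L a)) (op_comp (rho A) (rho (L b))) =
             z *: op_comp (rho (L c)) (op_comp (rho A) (rho (L d))).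
  move=> fA; have fc := @fsa_creation R G.
  have fcc p : fsa (op_comp A (L p)) by exact: fsa_comp_creation.
  have E p q : op_comp (rho (L p)) (op_comp (rho A) (rho (L q))) =
      rho (op_comp (L p) (op_comp A (L q))).
    by rewrite rhoM ?rhoM.
  by rewrite !E hA// rhoZ//; exact: fsa_creation_comp.
move=> T h; apply/eqP; rewrite -subr_eq0; apply/eqP.
have coefs k : inner (rho (L a) (T (rho (L b) h))) k = z * inner (rho (L c) (T (rho (L d) h))) k.
  have [k1 hk1] := op_adjoint (rho (L a)) k.
  have [k2 hk2] := op_adjoint (rho (L c)) k.
  rewrite hk1 hk2; have : wot_closure (rho @` fsa) T by rewrite rho_irr.
  apply: wot_closure_coef => _ [A fA <-]; rewrite -hk1 -hk2 -innerZl.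
  by have := congr1 (fun T : bounded_op H => T h) (hrho A fA) => /= ->.
set v := _ - _; apply/eqP; rewrite -(@dnorm_eq0 _ _ inner) /v; apply/eqP.
by rewrite [LHS]innerBl innerZl coefs subrr.
Qed.

Lemma rho0 : rho 0 = 0.
Proof.
have [_ rhoZ _ _] := rhoP; have := rhoZ 0 0 fsa0.
by rewrite !scale0r.
Qed.

Lemma rho_creation_neq0 p : exists h, rho (L p) h != 0.
Proof.
apply: contrapT => hN; have : rho (L p) = rho 0.
  rewrite rho0; apply: op_ext => h; rewrite op0E; apply/eqP/negPn/negP => h0.
  by apply: hN; exists h.
by move=> /(rho_inj (fsa_creation p) fsa0)/eqP; rewrite (negPf (creation_neq0 p)).
Qed.

(** Take T to be the rank one operator from the range of rho(L_x) to a vector that rho(L_y)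
    does not kill. *)
Lemma rep_transitive : transitive_graph G.
Proof.
move=> x y xy; apply: contrapT => hN.
have [h Ph] := rho_creation_neq0 (pvertex x).
have [g Qg] := rho_creation_neq0 (pvertex y).
have rel p : op_comp (L (pvertex y)) (op_comp (L p) (L (pvertex x))) =
   0 *: op_comp (L (pvertex y)) (op_comp (L p) (L (pvertex x))).
  rewrite scale0r creation_comp; case: eqVneq => [sp|_]; last first.
    by apply: op_ext => f; rewrite op_compE linear0.
  rewrite creation_comp prng_pmul//; case: eqVneq => // rp.
  by case: hN; exists p.
have := rep_relation rel (rank1 (rho (L (pvertex x)) h) g) h; rewrite scale0r.
rewrite [X in rho _ X](_ : _ = inner (rho (L (pvertex x)) h) (rho (L (pvertex x)) h) *: g)//.
rewrite linearZ => /eqP; rewrite scaler_eq0 (negPf Qg) orbF.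
by rewrite (@dnorm_eq0 _ _ inner) (negPf Ph).
Qed.

(** With T = <., P h> g and P = rho(L_x), the relation L_c L_p L_x = L_x L_p L_c becomes
    <P h, P h> rho(L_c) g = <rho(L_c) h, P h> P g. *)
Lemma rep_no_commuting_cycle (x : vertex G) (c : gpath G) :
  psrc c = x -> prng c = x -> c != pvertex x ->
  (forall p, psrc p = x -> prng p = x -> pmul c p = pmul p c) -> False.
Proof.
move=> sc rc cx comm; have [rhoD rhoZ rhoM _] := rhoP.
have [h Ph] := rho_creation_neq0 (pvertex x).
have rel p : op_comp (L c) (op_comp (L p) (L (pvertex x))) =
   1 *: op_comp (L (pvertex x)) (op_comp (L p) (L c)).
  have [px rx] : psrc (pvertex x) = x /\ prng (pvertex x) = x by [].
  rewrite scale1r !creation_comp rc rx; case: (eqVneq (psrc p) x) => [sp|_]; last first.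
    by apply: op_ext => f; rewrite !op_compE !linear0.
  rewrite !creation_comp !prng_pmul ?rc ?rx// sc px; case: (eqVneq x (prng p)) => // rp.
  by rewrite pmul_pvertex// pvertex_pmul ?prng_pmul ?rc// comm.
set P := rho (L (pvertex x)) in Ph.
have eqc g : rho (L c) g = (inner (rho (L c) h) (P h) / inner (P h) (P h)) *: P g.
  have := rep_relation rel (rank1 (P h) g) h; rewrite scale1r.
  rewrite [X in rho _ X](_ : _ = inner (P h) (P h) *: g)//.
  rewrite [X in _ = rho _ X](_ : _ = inner (rho (L c) h) (P h) *: g)//.
  rewrite !linearZ -/P => E; rewrite mulrC -scalerA -E scalerA mulVf ?scale1r//.
  by rewrite (@dnorm_eq0 _ _ inner).
move: (_ / _) eqc => z eqc.
have /(rho_inj (fsa_creation c)) : rho (L c) = rho (z *: L (pvertex x)).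
  by rewrite rhoZ; [apply: op_ext => g; rewrite eqc opZE|exact: fsa_creation].
move=> /(_ (fsaZ _ (fsa_creation _))).
move=> /(congr1 (fun T : bounded_op K => T (ell2_basis (pvertex x)))).
rewrite opZE !creation_vertex// => /(congr1 (fun f : K => f c)).
rewrite ell2_coordZ !ell2_basisE eqxx (negPf cx) mulr0 => /eqP.
by rewrite oner_eq0.
Qed.

End Necessity.

(** * Deterministic actions with square summable weights *)

Lemma sum_le_uniq (T : eqType) (K : numDomainType) (F : T -> K) (D D' : seq T) :
  (forall x, 0 <= F x) -> uniq D -> {subset D <= D'} ->
  \sum_(x <- D) F x <= \sum_(x <- D') F x.
Proof.
move=> F0; elim: D D' => [|a D ih] D' /=; first by rewrite big_nil sumr_ge0.
move=> /andP[aD uD] sD; have aD' : a \in D' by rewrite sD ?mem_head.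
rewrite big_cons [leRHS](big_rem a)//= lerD2l.
apply: ih => // x xD; have : x \in D' by apply: sD; rewrite inE xD orbT.
have xa : x != a by apply: contraNneq aD => <-.
by rewrite (perm_mem (perm_to_rem (sD a (mem_head _ _)))) inE (negPf xa).
Qed.

Section Words.
Context {T : eqType}.
Variable K : seq T.

Fixpoint words n : seq (seq T) :=
  if n is n'.+1 then [::] :: [seq e :: s | e <- K, s <- words n'] else [:: [::]].

Lemma mem_words n s : {subset s <= K} -> (size s <= n)%N -> s \in words n.
Proof.
elim: n s => [|n ih] [|e s]//= sK sn; rewrite inE /=.
apply/allpairsP; exists (e, s); split=> //=; first by apply: sK; rewrite mem_head.
by apply: ih => // x xs; apply: sK; rewrite inE xs orbT.
Qed.

End Words.

Lemma leq_max_size (T : eqType) (D : seq (seq T)) s : s \in D ->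
  (size s <= \max_(t <- D) size t)%N.
Proof. by move=> sD; rewrite (big_rem s)//= leq_maxl. Qed.

Section WeightedRun.
Context {R : realType} {E X : choiceType}.
Variables (act : E -> X -> X) (wt : E -> X -> R).
Hypothesis wt_sum : forall D : seq (E * X), uniq D ->
  \sum_(d <- D) wt d.1 d.2 ^+ 2 <= 4^-1.

Fixpoint run (s : seq E) x := if s is e :: s' then run s' (act e x) else x.

Fixpoint pwt (s : seq E) x : R := if s is e :: s' then wt e x * pwt s' (act e x) else 1.

Lemma run_cat s t x : run (s ++ t) x = run t (run s x).
Proof. by elim: s x => /=. Qed.

Lemma pwt_cat s t x : pwt (s ++ t) x = pwt s x * pwt t (run s x).
Proof. by elim: s x => [|e s ih] x /=; rewrite ?mul1r// ih mulrA. Qed.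

(** Splitting off the first letter gives the recursion s(n+1) <= 1 + s(n) / 4 for the sum over
    words of length at most n. *)
Lemma pwt_words_sum (K : seq E) n x : uniq K ->
  \sum_(s <- words K n) pwt s x ^+ 2 <= 2.
Proof.
move=> uK; elim: n x => [|n ih] x /=; first by rewrite big_seq1 expr1n ler1n.
rewrite big_cons expr1n big_allpairs_dep /=.
apply: (@le_trans _ _ (1 + \sum_(e <- K) wt e x ^+ 2 * 2)).
  rewrite lerD2l; apply: ler_sum => e _.
  under eq_bigr do rewrite exprMn; rewrite -mulr_sumr ler_wpM2l ?sqr_ge0//.
rewrite -mulr_suml.
have := @wt_sum [seq (e, x) | e <- K]; rewrite big_map map_inj_uniq; last by move=> ? ? [].
by move=> /(_ uK) /=; lra.
Qed.

Lemma pwt_sum (D : seq (seq E)) x : uniq D -> \sum_(s <- D) pwt s x ^+ 2 <= 2.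
Proof.
move=> uD; pose K := undup (flatten D).
apply: le_trans (@pwt_words_sum K (\max_(t <- D) size t) x (undup_uniq _)).
apply: sum_le_uniq => // [s|s sD]; first by rewrite sqr_ge0.
apply: mem_words; last exact: leq_max_size.
by move=> e es; rewrite mem_undup; apply/flattenP; exists s.
Qed.

(** The empty word contributes only the pair ([::], y).  For the other words the first letter
    alone makes the sum over all states finite. *)
Lemma pwt_fiber_sum (D : seq (seq E * X)) y : uniq D ->
  (forall d, d \in D -> run d.1 d.2 = y) ->
  \sum_(d <- D) pwt d.1 d.2 ^+ 2 <= 2.
Proof.
move=> uD Dy; rewrite (bigID (fun d : seq E * X => nilp d.1)) /=.
rewrite -[X in X + _]big_filter -[X in _ + X]big_filter.
have p0 (d : seq E * X) : 0 <= pwt d.1 d.2 ^+ 2 by rewrite sqr_ge0.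
have -> : 2 = 1 + 1 :> R by lra.
apply: lerD.
  apply: (@le_trans _ _ (\sum_(d <- [:: ([::] : seq E, y)]) pwt d.1 d.2 ^+ 2)).
    apply: sum_le_uniq => //; first exact: filter_uniq.
    move=> [s x]; rewrite mem_filter /= inE => /andP[/nilP -> /Dy /= ->].
    exact: eqxx.
  by rewrite big_seq1 /= expr1n.
pose K := undup (flatten [seq d.1 | d <- D]).
pose Y := undup [seq d.2 | d <- D].
pose KX := [seq (e, x) | e <- K, x <- Y].
have uKX : uniq KX by apply: allpairs_uniq; rewrite ?undup_uniq// => -[? ?] [? ?] _ _ [-> ->].
pose n := \max_(t <- [seq d.1 | d <- D]) size t.
apply: (@le_trans _ _ (\sum_(d <- [seq (e.1 :: s, e.2) | e <- KX, s <- words K n])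
    pwt d.1 d.2 ^+ 2)).
  apply: sum_le_uniq => //; first exact: filter_uniq.
  move=> [[|e s] x]; rewrite mem_filter //= => dD.
  have sK : {subset e :: s <= K}.
    move=> f fs; rewrite mem_undup; apply/flattenP; exists (e :: s) => //.
    by apply/mapP; exists (e :: s, x).
  apply/allpairsP; exists ((e, x), s); split=> //=.
    apply/allpairsP; exists (e, x); split=> //=; first by apply: sK; rewrite mem_head.
    by rewrite mem_undup; apply/mapP; exists (e :: s, x).
  apply: mem_words => [f fs|]; first by apply: sK; rewrite inE fs orbT.
  apply: leq_trans (leq_max_size (s := e :: s) _) => //.
  by apply/mapP; exists (e :: s, x).
rewrite big_allpairs_dep /=.
apply: (@le_trans _ _ (\sum_(e <- KX) wt e.1 e.2 ^+ 2 * 2)).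
  apply: ler_sum => e _.
  under eq_bigr do rewrite exprMn; rewrite -mulr_sumr ler_wpM2l ?sqr_ge0//.
  by apply: pwt_words_sum; exact: undup_uniq.
by rewrite -mulr_suml; have := wt_sum uKX; lra.
Qed.

End WeightedRun.

(** * Operators defined by an orthogonal family *)

Section Bessel.
Context {R : realType} {H : hilbertType R} {X : choiceType}.
Local Notation C := R[i].
Variables (g : X -> H) (M : C).
Hypothesis M0 : 0 <= M.
Hypothesis g_ortho : forall x y, x != y -> inner (g x) (g y) = 0.
Hypothesis g_norm : forall x, `|g x| <= M.

(** With z the sum of the <c, g y> g y, both <c, z> and, up to the factor M^2, |z|^2 are the
    sum b to be bounded; Cauchy-Schwarz gives b^2 <= |c|^2 M^2 b. *)
Lemma bessel (c : H) (A : {fset X}) :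
  \sum_(y <- A) `|inner c (g y)| ^+ 2 <= (M * `|c|) ^+ 2.
Proof.
pose z := \sum_(y <- A) inner c (g y) *: g y.
set b := \sum_(y <- A) _.
have b0 : 0 <= b by rewrite sumr_ge0// => y _; rewrite exprn_ge0.
have cz : inner c z = b.
  by rewrite inner_sumr; apply: eq_bigr => y _; rewrite innerZr normCKC.
have gz y : y \in A -> inner (g y) z = (inner c (g y))^* * `|g y| ^+ 2.
  move=> yA; rewrite inner_sumr (big_fsetD1 y)//= innerZr -sqr_normE.
  rewrite big_seq big1 ?addr0// => x; rewrite !inE => /andP[xy _].
  by rewrite innerZr g_ortho ?mulr0// eq_sym.
have z2 : `|z| ^+ 2 <= M ^+ 2 * b.
  rewrite sqr_normE {1}/z inner_suml mulr_sumr big_seq [leRHS]big_seq.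
  apply: ler_sum => y yA; rewrite innerZl gz// mulrA -normCK mulrC.
  by rewrite ler_wpM2r ?exprn_ge0// lerXn2r ?nnegrE//; exact: le_trans (g_norm y).
have : b ^+ 2 <= (M * `|c|) ^+ 2 * b.
  rewrite -[in leLHS]cz; apply: (@le_trans _ _ (`|inner c z| ^+ 2)).
    by rewrite cz ger0_norm.
  apply: (@le_trans _ _ ((`|c| * `|z|) ^+ 2)).
    by rewrite lerXn2r ?nnegrE ?mulr_ge0// norm_inner_le.
  have -> : (M * `|c|) ^+ 2 * b = `|c| ^+ 2 * (M ^+ 2 * b) by ring.
  by rewrite exprMn ler_wpM2l ?exprn_ge0.
have [->|bn0] := eqVneq b 0; first by rewrite exprn_ge0// mulr_ge0.
by rewrite expr2 ler_pM2r// lt_def bn0.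
Qed.

End Bessel.

Section AnalysisOperator.
Context {R : realType} {Z X : choiceType}.
Local Notation C := R[i].
Variables (g : X -> ell2 R Z) (M : C).
Hypothesis M0 : 0 <= M.
Hypothesis g_ortho : forall x y, x != y -> inner (g x) (g y) = 0.
Hypothesis g_norm : forall x, `|g x| <= M.

Lemma analysis_subproof (c : ell2 R Z) : (fun y => inner c (g y)) \in ell2_pred.
Proof.
apply/asboolP/square_summableP; exists ((M * `|c|) ^+ 2) => A.
by rewrite partial_sumE; exact: bessel.
Qed.

Definition analysis c : ell2 R X := Ell2 (analysis_subproof c).

Lemma analysisP a c d : analysis (a *: c + d) = a *: analysis c + analysis d.
Proof.
by apply: ell2_eq => y; rewrite ell2_coordP -[LHS]/(inner _ _) innerDl innerZl.
Qed.

Lemma analysis_norm c : `|analysis c| <= M * `|c|.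
Proof.
apply: ell2_norm_le; first by rewrite mulr_ge0.
by move=> A; rewrite partial_sumE; exact: bessel.
Qed.

End AnalysisOperator.

Section Tensor.
Context {R : realType} {Z X : choiceType}.
Local Notation C := R[i].
Variables (F : X -> ell2 R Z) (M : C).
Hypothesis M0 : 0 <= M.
Hypothesis FM : forall x, `|F x| <= M.

Lemma tens_sum (h : ell2 R X) (A : {fset Z * X}) :
  partial_sum (fun p : Z * X => `|h p.2 * F p.2 p.1| ^+ 2) A <= (M * `|h|) ^+ 2.
Proof.
pose A1 := [fset p.1 | p in A]%fset; pose A2 := [fset p.2 | p in A]%fset.
rewrite partial_sumE.
apply: (@le_trans _ _ (\sum_(p <- [seq (z, x) | x <- A2, z <- A1])
    `|h p.2 * F p.2 p.1| ^+ 2)).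
  apply: sum_le_uniq; [by move=> x; rewrite exprn_ge0|exact: fset_uniq|].
  move=> [z x] zxA; apply/allpairsP; exists (x, z); split=> //=.
    by apply/imfsetP; exists (z, x).
  by apply/imfsetP; exists (z, x).
rewrite big_allpairs_dep /= exprMn.
apply: (@le_trans _ _ (\sum_(x <- A2) `|h x| ^+ 2 * M ^+ 2)).
  apply: ler_sum => x _; under eq_bigr do rewrite normrM exprMn.
  rewrite -mulr_sumr ler_wpM2l ?exprn_ge0//.
  rewrite -partial_sumE (le_trans (ell2_norm_ge _ _))//.
  by rewrite lerXn2r ?nnegrE//; exact: le_trans (FM x).
rewrite -mulr_suml mulrC ler_wpM2l//.
  by rewrite exprn_ge0.
by rewrite -partial_sumE ell2_norm_ge.
Qed.

Lemma tens_subproof (h : ell2 R X) : (fun p : Z * X => h p.2 * F p.2 p.1) \in ell2_pred.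
Proof.
apply/asboolP/square_summableP; exists ((M * `|h|) ^+ 2) => A; exact: tens_sum.
Qed.

(** The sum over x of F x (x) (h x xi_x), as a vector of l^2(Z) (x) l^2(X) = l^2(Z * X). *)
Definition tens h : ell2 R (Z * X)%type := Ell2 (tens_subproof h).

Lemma tens_norm h : `|tens h| <= M * `|h|.
Proof. by apply: ell2_norm_le; [rewrite mulr_ge0|exact: tens_sum]. Qed.

Lemma tensE h p : tens h p = h p.2 * F p.2 p.1. Proof. by []. Qed.

Lemma tensP a h k : tens (a *: h + k) = a *: tens h + tens k.
Proof.
by apply: ell2_eq => p; rewrite ell2_coordP !tensE ell2_coordP mulrDl mulrA.
Qed.

End Tensor.

(** * The representation attached to a weighted action *)

Section WeightedRep.
Context {R : realType} {G : digraph} {X : countType}.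
Local Notation C := R[i].
Local Notation K := (ell2 R (gpath G)).
Local Notation fsa := (free_semigroupoid_algebra R G).
Local Notation L := (@creation R G).
Variables (lab : X -> vertex G) (act : edge G -> X -> X) (wt : edge G -> X -> R).
Hypothesis lab_act : forall e x, edge_src e = lab x -> lab (act e x) = edge_rng e.
Hypothesis wt_sum : forall D : seq (edge G * X), uniq D ->
  \sum_(d <- D) wt d.1 d.2 ^+ 2 <= 4^-1.
Local Notation run := (run act).
Local Notation pwt := (pwt act wt).
Implicit Types (p q w : gpath G) (x y : X) (A B : bounded_op K).

Lemma lab_run s x : is_path (lab x) s -> lab (run s x) = path_end (lab x) s.
Proof.
elim: s x => //= e s ih x /andP[/eqP ex ps].
by rewrite ih lab_act.
Qed.

Lemma lab_run_gpath p x : psrc p = lab x -> lab (run (pedges p) x) = prng p.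
Proof. by move=> px; rewrite lab_run -px//; exact: gpathP. Qed.

(** The weights of the pairs (w, x) with w.x = y.  Different y give disjoint supports, whence the
    orthogonality that makes [evaluate] bounded. *)
Definition fiber_fun y (d : gpath G * X) : C :=
  if (psrc d.1 == lab d.2) && (run (pedges d.1) d.2 == y)
  then (pwt (pedges d.1) d.2)%:C else 0.

Lemma fiber_sum y (A : {fset gpath G * X}) :
  partial_sum (fun d => `|fiber_fun y d| ^+ 2) A <= 2 ^+ 2.
Proof.
pose P := fun d : gpath G * X => (psrc d.1 == lab d.2) && (run (pedges d.1) d.2 == y).
pose B := [seq (pedges d.1, d.2) | d <- A & P d].
have uB : uniq B.
  rewrite map_inj_in_uniq ?filter_uniq ?fset_uniq// => -[p x] [q z].
  rewrite !mem_filter /P /= => /andP[/andP[/eqP px _] _] /andP[/andP[/eqP qz _] _].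
  by case=> pq xz; congr (_, _) => //; apply: gpath_eq => //; rewrite px qz xz.
have By d : d \in B -> run d.1 d.2 = y.
  by move=> /mapP[c]; rewrite mem_filter => /andP[/andP[_ /eqP <-] _] ->.
have := pwt_fiber_sum wt_sum uB By.
rewrite big_map big_filter /= => hB.
rewrite partial_sumE.
have -> : \sum_(d <- A) `|fiber_fun y d| ^+ 2 =
   (\sum_(d <- A | P d) pwt (pedges d.1) d.2 ^+ 2)%:C.
  rewrite rmorph_sum [RHS]big_mkcond /=; apply: eq_bigr => d _.
  rewrite /fiber_fun -/(P d); case: (P d); last by rewrite normr0 expr0n.
  by rewrite normc_def /= expr0n /= addr0 sqrtr_sqr -rmorphXn /= real_normK ?num_real.
rewrite -natrX -(rmorph_nat (real_complex R)) lecR.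
by apply: le_trans hB _; rewrite ler_nat.
Qed.

Lemma fiber_subproof y : fiber_fun y \in ell2_pred.
Proof.
by apply/asboolP/square_summableP; exists (2 ^+ 2) => A; exact: fiber_sum.
Qed.

Definition fiber y : ell2 R (gpath G * X)%type := Ell2 (fiber_subproof y).

Lemma fiberE y p x : fiber y (p, x) =
  if (psrc p == lab x) && (run (pedges p) x == y) then (pwt (pedges p) x)%:C else 0.
Proof. by []. Qed.

Lemma fiber_norm y : `|fiber y| <= 2.
Proof. by apply: ell2_norm_le => // A; exact: fiber_sum. Qed.

Lemma fiber_ortho y z : y != z -> inner (fiber y) (fiber z) = 0.
Proof.
move=> yz; apply: sumP.
rewrite (_ : partial_sum _ = fun=> 0); first exact: cvg_cst.
apply/funext => A; rewrite partial_sumE big1// => d _ /=.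
rewrite /fiber_fun; case: (_ == lab d.2) => /=; last by rewrite mul0r.
by case: eqP => [->|]; rewrite ?mul0r// (negPf yz) conjC0 mulr0.
Qed.

Let two0 : 0 <= 2 :> C. Proof. by []. Qed.

(** The map xi_w (x) xi_x |-> T_w xi_x; see [evaluate_basis]. *)
Definition evaluate := analysis two0 fiber_ortho fiber_norm.

Lemma evaluateE c y : evaluate c y = inner c (fiber y). Proof. by []. Qed.

Lemma evaluateP a c d : evaluate (a *: c + d) = a *: evaluate c + evaluate d.
Proof. exact: analysisP. Qed.

Lemma evaluate_norm c : `|evaluate c| <= 2 * `|c|.
Proof. exact: analysis_norm. Qed.

Lemma evaluate_basis p x : evaluate (ell2_basis (p, x)) =
  if psrc p == lab x then (pwt (pedges p) x)%:C *: ell2_basis (run (pedges p) x) else 0.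
Proof.
apply: ell2_eq => y; rewrite evaluateE inner_basisl fiberE.
case: (psrc p == lab x); last by rewrite conjC0.
rewrite ell2_coordZ ell2_basisE eq_sym; case: (y == _); last by rewrite conjC0 mulr0.
by rewrite mulr1; apply/eqP; rewrite eq_complex /= eqxx oppr0 eqxx.
Qed.

Definition vacuum_image A x : K := A (ell2_basis (pvertex (lab x))).

Lemma vacuum_image_norm A x : `|vacuum_image A x| <= op_norm A.
Proof. by apply: op_norm_ge; rewrite ell2_basis_norm. Qed.

(** An element A of the algebra is formally a series of paths, the part of it that starts at the
    label of x being A xi_(lab x); hence this candidate for the action of A on xi_x. *)
Definition rep_fun A (h : ell2 R X) : ell2 R X :=
  evaluate (tens (op_norm_ge0 A) (vacuum_image_norm A) h).

Lemma rep_funP A a h k : rep_fun A (a *: h + k) = a *: rep_fun A h + rep_fun A k.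
Proof. by rewrite /rep_fun tensP evaluateP. Qed.

Lemma rep_fun_norm A h : `|rep_fun A h| <= 2 * op_norm A * `|h|.
Proof.
by apply: le_trans (evaluate_norm _) _; rewrite -mulrA ler_wpM2l// tens_norm.
Qed.

Lemma rep_fun_subproof A : rep_fun A \in bounded_op_pred.
Proof.
have rl : linear (rep_fun A) by exact: rep_funP.
apply/asboolP; split => //.
pose f : {linear ell2 R X -> ell2 R X} := HB.pack (rep_fun A) (GRing.isLinear.Build _ _ _ _ _ rl).
apply: (@bounded_linear_continuous _ _ _ f (2 * op_norm A)).
  by rewrite mulr_ge0 ?op_norm_ge0.
exact: rep_fun_norm.
Qed.

Definition weighted_rep A : bounded_op (ell2 R X) := BoundedOp (rep_fun_subproof A).

Lemma rep_norm A : op_norm (weighted_rep A) <= 2 * op_norm A.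
Proof.
apply: op_norm_le => h h1; apply: le_trans (rep_fun_norm A h) _.
by rewrite ler_piMr// mulr_ge0 ?op_norm_ge0.
Qed.

Let const_norm (f : K) (x : X) : `|f| <= `|f|. Proof. by []. Qed.

(** The map xi_w |-> T_w xi_x from l^2(paths); see [orbit_map_basis]. *)
Definition orbit_map x (f : K) : ell2 R X :=
  evaluate (tens (normr_ge0 f) (const_norm f) (ell2_basis x)).

Lemma rep_basis A x : weighted_rep A (ell2_basis x) = orbit_map x (vacuum_image A x).
Proof.
rewrite /weighted_rep /= /rep_fun /orbit_map; congr evaluate; apply: ell2_eq => d.
rewrite !tensE ell2_basisE.
by case: eqP => [->|]; rewrite ?mul0r.
Qed.

Lemma orbit_mapP x a f k : orbit_map x (a *: f + k) = a *: orbit_map x f + orbit_map x k.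
Proof.
rewrite /orbit_map -evaluateP; congr evaluate; apply: ell2_eq => d.
by rewrite ell2_coordP !tensE ell2_coordP mulrDr mulrCA.
Qed.

Lemma orbit_map_norm x f : `|orbit_map x f| <= 2 * `|f|.
Proof.
apply: le_trans (evaluate_norm _) _; rewrite ler_wpM2l//.
by apply: le_trans (tens_norm _ _ _) _; rewrite ell2_basis_norm mulr1.
Qed.

Lemma orbit_map_basis x w : orbit_map x (ell2_basis w) =
  if psrc w == lab x then (pwt (pedges w) x)%:C *: ell2_basis (run (pedges w) x) else 0.
Proof.
rewrite -evaluate_basis /orbit_map; congr evaluate; apply: ell2_eq => -[p y].
rewrite tensE !ell2_basisE -natrM mulnb andbC.
by rewrite xpair_eqE.
Qed.

Lemma orbit_map_coef x y : exists k : K, forall f, orbit_map x f y = inner f k.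
Proof.
apply: (@riesz _ _ (fun f => orbit_map x f y) 2) => [a f k|f].
  by rewrite orbit_mapP ell2_coordP.
by apply: le_trans (orbit_map_norm x f); exact: ell2_norm_coord.
Qed.

Lemma orbit_map0 x : orbit_map x 0 = 0.
Proof. by have := orbit_mapP x (-1) 0 0; rewrite scaler0 addr0 scaleN1r addNr. Qed.

Lemma orbit_mapZ x a f : orbit_map x (a *: f) = a *: orbit_map x f.
Proof. by have := orbit_mapP x a f 0; rewrite orbit_map0 !addr0. Qed.

Lemma rep_creation_basis p x : weighted_rep (L p) (ell2_basis x) =
  if psrc p == lab x then (pwt (pedges p) x)%:C *: ell2_basis (run (pedges p) x) else 0.
Proof.
rewrite rep_basis /vacuum_image; have [px|px] := eqVneq (psrc p) (lab x).
  by rewrite creation_vertex// orbit_map_basis px eqxx.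
by rewrite creation_basis (negPf px) orbit_map0.
Qed.

(** Each coordinate of both sides is a matrix coefficient of A, so that only creation operators
    matter; for these the identity says that T_p (T_w xi_x) = T_(pw) xi_x. *)
Lemma orbit_map_intertwine_basis A x w : fsa A ->
  orbit_map x (A (ell2_basis w)) = weighted_rep A (orbit_map x (ell2_basis w)).
Proof.
move=> fA; rewrite orbit_map_basis; have [wx|wx] := eqVneq (psrc w) (lab x); last first.
  rewrite linear0; apply: ell2_eq => y; have [k hk] := orbit_map_coef x y.
  rewrite hk -[RHS](mul0r (inner (A 0) k)); apply: fsa_coef fA => p.
  rewrite mul0r -hk creation_basis; case: ifP => [/eqP pw|_]; last by rewrite orbit_map0.
  by rewrite orbit_map_basis psrc_pmul// (negPf wx).
rewrite linearZ /= -/(weighted_rep A) -[rep_fun A _]/(weighted_rep A _) rep_basis.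
set z := run _ _; have labz : lab z = prng w by exact: lab_run_gpath.
apply: ell2_eq => y; have [k hk] := orbit_map_coef x y; have [l hl] := orbit_map_coef z y.
rewrite ell2_coordZ hk hl /vacuum_image; apply: fsa_coef fA => p.
rewrite -hk -hl creation_basis.
have [pw|pw] := eqVneq (psrc p) (prng w); last first.
  have pz : (psrc p == prng (pvertex (lab z))) = false by rewrite labz; exact: negPf pw.
  by rewrite creation_basis pz !orbit_map0 mulr0.
rewrite creation_vertex ?labz// !orbit_map_basis psrc_pmul// wx eqxx labz pw eqxx.
rewrite !ell2_coordZ pedges_pmul// run_cat pwt_cat -/z mulrA -rmorphM.
by [].
Qed.

Lemma orbit_map_intertwine A x f : fsa A -> orbit_map x (A f) = weighted_rep A (orbit_map x f).
Proof.
move=> fA; apply: ell2_eq => y; apply/eqP; rewrite -subr_eq0; apply/eqP.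
apply: (@functional_eq0 _ _ (fun f => orbit_map x (A f) y - weighted_rep A (orbit_map x f) y)
  (2 * op_norm A + op_norm (weighted_rep A) * 2)) => [a h k|h|w].
- rewrite (linearP A) !orbit_mapP (linearP (weighted_rep A)) !ell2_coordP.
  by rewrite mulrBr opprD addrACA.
- apply: le_trans (ler_normB _ _) _; rewrite mulrDl lerD//.
    apply: le_trans (ell2_norm_coord _ _) _; apply: le_trans (orbit_map_norm _ _) _.
    by rewrite -mulrA ler_wpM2l// op_norm_le_mul.
  apply: le_trans (ell2_norm_coord _ _) _; apply: le_trans (op_norm_le_mul _ _) _.
  by rewrite -mulrA ler_wpM2l ?op_norm_ge0// orbit_map_norm.
- by rewrite orbit_map_intertwine_basis// subrr.
Qed.

Lemma rep_comp A B : fsa A ->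
  weighted_rep (op_comp A B) = op_comp (weighted_rep A) (weighted_rep B).
Proof.
move=> fA; apply: op_ext_basis => x; rewrite op_compE !rep_basis.
by rewrite -orbit_map_intertwine.
Qed.

Lemma repD A B : weighted_rep (A + B) = weighted_rep A + weighted_rep B.
Proof.
apply: op_ext_basis => x; rewrite opDE !rep_basis -[orbit_map x (vacuum_image A x)]scale1r.
by rewrite -orbit_mapP scale1r.
Qed.

Lemma repZ a A : weighted_rep (a *: A) = a *: weighted_rep A.
Proof. by apply: op_ext_basis => x; rewrite opZE !rep_basis -orbit_mapZ. Qed.

Lemma rep_continuous : continuous weighted_rep.
Proof.
have rl : linear weighted_rep by move=> a A B; rewrite repD repZ.
pose f : {linear bounded_op K -> bounded_op (ell2 R X)} :=
  HB.pack weighted_rep (GRing.isLinear.Build _ _ _ _ _ rl).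
by apply: (@bounded_linear_continuous _ _ _ f 2) => // A; exact: rep_norm.
Qed.

Lemma rep_representation : representation fsa weighted_rep.
Proof.
split.
- by move=> S T _ _; exact: repD.
- by move=> a T _; exact: repZ.
- by move=> S T fS _; exact: rep_comp.
- exact: continuous_subspaceT rep_continuous.
Qed.

End WeightedRep.

Section Faithful.
Context {R : realType} {G : digraph} {X : countType}.
Local Notation C := R[i].
Local Notation fsa := (free_semigroupoid_algebra R G).
Variables (lab : X -> vertex G) (act : edge G -> X -> X) (wt : edge G -> X -> R).
Hypothesis wt_sum : forall D : seq (edge G * X), uniq D ->
  \sum_(d <- D) wt d.1 d.2 ^+ 2 <= 4^-1.
Hypothesis wt_gt0 : forall e x, 0 < wt e x.
Local Notation run := (run act).
Local Notation pwt := (pwt act wt).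
Local Notation rep := (weighted_rep lab act wt_sum).
Implicit Types (p q w : gpath G) (x y : X).

Lemma pwt_gt0 s x : 0 < pwt s x.
Proof. by elim: s x => //= e s ih x; rewrite mulr_gt0. Qed.

Lemma wt_le_half e x : wt e x <= 2^-1.
Proof.
have := @wt_sum [:: (e, x)] isT; rewrite big_seq1 /= => h.
rewrite -ler_sqr ?nnegrE ?invr_ge0// ?(ltW (wt_gt0 _ _))//.
by apply: le_trans h _; rewrite expr2 -invfM -natrM.
Qed.

Lemma pwt_le s x : pwt s x <= 2^-1 ^+ size s.
Proof.
elim: s x => //= e s ih x; rewrite exprS ler_pM ?(ltW (wt_gt0 _ _)) ?(ltW (pwt_gt0 _ _))//.
exact: wt_le_half.
Qed.

Lemma pwt_le1 s x : pwt s x <= 1.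
Proof.
by apply: le_trans (pwt_le _ _) _; rewrite exprn_ile1// invf_le1// ler1n.
Qed.

(** Among the words that lead u to w0.u, the word w0 carries almost all of the weight. *)
Definition isolates (eps : R) (u : X) (w0 : gpath G) :=
  forall D : seq (seq (edge G)), uniq D ->
    (forall s, s \in D -> [/\ is_path (lab u) s, s != pedges w0 & run s u = run (pedges w0) u]) ->
    \sum_(s <- D) pwt s u ^+ 2 <= (eps * pwt (pedges w0) u) ^+ 2.

(** If the image of D is 0, then D xi_v is orthogonal to the vector k of the weights of the words
    that lead u to w0.u.  When u isolates w0, k is close to a multiple of xi_w0, so the
    coefficient of D xi_v at w0 is arbitrarily small. *)
Lemma rep_faithful :
  (forall w0 (eps : R), 0 < eps -> exists u, lab u = psrc w0 /\ isolates eps u w0) ->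
  faithful fsa rep.
Proof.
move=> iso S T fS fT ST.
suff D0 : S - T = 0 by apply/eqP; rewrite -subr_eq0 D0.
have fD : fsa (S - T) by rewrite -scaleN1r; apply: fsaD => //; exact: fsaZ.
have repD0 : rep (S - T) = 0.
  by rewrite -scaleN1r repD repZ -ST scaleN1r subrr.
move: (S - T) fD repD0 => D fD repD0 {S T fS fT ST}.
apply: fsa_eq0 => // v; apply: ell2_eq => w0.
rewrite -[LHS]ell2_inner_basis.
have [sw|sw] := eqVneq (psrc w0) v; last first.
  apply: fsa_coef_eq0 fD => p; rewrite ell2_inner_basis creation_basis.
  case: eqP => // pv; rewrite ell2_basisE; case: eqP => // wp.
  by move: sw; rewrite wp psrc_pmul// eqxx.
set f := D _.
rewrite ell2_inner_basis; apply/eqP; rewrite -normr_le0; apply/ler_addgt0Pr => e e0; rewrite add0r.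
pose eps := complex.Re e / (complex.Re `|f| + 1).
have eE : e = (complex.Re e)%:C by rewrite gt0_Re.
have fE : `|f| = (complex.Re `|f|)%:C by rewrite ger0_Re.
have f0 : 0 <= complex.Re `|f| by rewrite -lecR -fE normr_ge0.
have eps0 : 0 < eps by rewrite divr_gt0 ?ltr_wpDl// -ltcR -eE.
have [u [lu isou]] := iso w0 eps eps0.
pose y := run (pedges w0) u.
have sf0 : orbit_map lab act wt_sum u f y = 0.
  have := congr1 (fun T : bounded_op (ell2 R X) => T (ell2_basis u)) repD0.
  rewrite op0E rep_basis /vacuum_image lu sw => h; by rewrite /f h.
have [k hk] := orbit_map_coef lab act wt_sum u y.
have kE w : k w = if (psrc w == lab u) && (run (pedges w) u == y)
    then (pwt (pedges w) u)%:C else 0.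
  apply: (can_inj (@conjCK _)); rewrite -inner_basisl -hk orbit_map_basis.
  case: (psrc w == lab u); last by rewrite conjC0.
  rewrite andTb ell2_coordZ ell2_basisE eq_sym; case: (_ == y); last by rewrite mulr0 conjC0.
  by rewrite mulr1; apply/esym/eqP; rewrite eq_complex /= eqxx oppr0 eqxx.
pose c : R := pwt (pedges w0) u.
have c0 : 0 < c by exact: pwt_gt0.
have cC0 : 0 < c%:C :> C by rewrite ltcR.
pose r := k - c%:C *: ell2_basis w0.
have r_le : `|r| <= (eps * c)%:C.
  apply: ell2_norm_le; first by rewrite lecR mulr_ge0// ltW.
  move=> A.
  pose P w := [&& psrc w == lab u, run (pedges w) u == y & w != w0].
  have rE w : `|r w| ^+ 2 = (if P w then pwt (pedges w) u ^+ 2 else 0)%:C.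
    rewrite /r ell2_coordB ell2_coordZ ell2_basisE kE /P.
    have [->|ww] := eqVneq w w0.
      by rewrite -lu eqxx /y eqxx /= mulr1 subrr normr0 expr0n.
    rewrite mulr0 subr0 andbT; case: ifP => _; last by rewrite normr0 expr0n.
    by rewrite normc_def /= expr0n /= addr0 sqrtr_sqr -rmorphXn /= real_normK ?num_real.
  rewrite partial_sumE (eq_bigr _ (fun w _ => rE w)) -rmorph_sum -rmorphXn lecR.
  rewrite -big_mkcond -big_filter -(big_map (@pedges G) xpredT (fun s => pwt s u ^+ 2)).
  apply: isou.
    rewrite map_inj_in_uniq ?filter_uniq ?fset_uniq// => p q.
    rewrite !mem_filter => /andP[/and3P[/eqP pu _ _] _] /andP[/and3P[/eqP qu _ _] _] pq.
    by apply: gpath_eq => //; rewrite pu qu.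
  move=> s /mapP[w]; rewrite mem_filter => /andP[/and3P[/eqP wu /eqP wy ww] _] ->.
  split=> //; first by rewrite -wu; exact: gpathP.
  by apply: contraNneq ww => ww; apply/eqP; apply: gpath_eq => //; rewrite wu lu.
have kr : k = c%:C *: ell2_basis w0 + r by rewrite /r addrC subrK.
have : inner f k = 0 by rewrite -hk.
rewrite kr innerDr innerZr ell2_inner_basis => /eqP; rewrite addr_eq0 => /eqP hfr.
have : `|c%:C * f w0| <= c%:C * e.
  have -> : c%:C * f w0 = - inner f r.
    by rewrite -hfr; congr (_ * _); apply/esym/eqP; rewrite eq_complex /= eqxx oppr0 eqxx.
  rewrite normrN; apply: le_trans (norm_inner_le _ _) _.
  apply: le_trans (ler_wpM2l (normr_ge0 _) r_le) _.
  rewrite fE eE -!rmorphM lecR /eps; set a := complex.Re `|f|; set b := complex.Re e.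
  have b0 : 0 <= b by rewrite ltW// -ltcR -eE.
  have a1 : 0 < a + 1 by rewrite ltr_wpDl.
  rewrite [leLHS]mulrA [leLHS]mulrC ler_wpM2l ?(ltW c0)//.
  rewrite mulrA ler_pdivrMr// mulrC ler_wpM2l// lerDl ler01.
  by [].
by rewrite normrM gtr0_norm// ler_pM2l.
Qed.

End Faithful.

Section Irreducible.
Context {R : realType} {G : digraph} {X : countType}.
Local Notation C := R[i].
Local Notation fsa := (free_semigroupoid_algebra R G).
Local Notation L := (@creation R G).
Variables (lab : X -> vertex G) (act : edge G -> X -> X) (wt : edge G -> X -> R).
Hypothesis lab_act : forall e x, edge_src e = lab x -> lab (act e x) = edge_rng e.
Hypothesis wt_sum : forall D : seq (edge G * X), uniq D ->
  \sum_(d <- D) wt d.1 d.2 ^+ 2 <= 4^-1.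
Hypothesis wt_gt0 : forall e x, 0 < wt e x.
Local Notation run := (run act).
Local Notation pwt := (pwt act wt).
Local Notation rep := (weighted_rep lab act wt_sum).

Lemma half_pow_small (K e : R) : 0 < K -> 0 < e -> exists n, K * 2^-1 ^+ n <= e.
Proof.
move=> K0 e0; exists (Num.bound (K / e)).
have := archi_boundP (ltW (divr_gt0 K0 e0)); set n := Num.bound _ => Kn.
have n2 : n%:R <= 2 ^+ n :> R by rewrite -natrX ler_nat ltnW// ltn_expl.
have p2 : 0 < 2 ^+ n :> R by rewrite exprn_gt0.
rewrite exprVn ler_pdivrMr// mulrC -ler_pdivrMr//.
exact: le_trans (ltW Kn) n2.
Qed.

Lemma pwt_sum_state v (A : seq X) : v != [::] -> uniq A ->
  \sum_(x <- A) pwt v x ^+ 2 <= 1.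
Proof.
case: v => //= e s _ uA.
apply: (@le_trans _ _ (\sum_(x <- A) wt e x ^+ 2)).
  apply: ler_sum => x _; rewrite exprMn ler_piMr ?sqr_ge0//.
  by apply: exprn_ile1; [exact/ltW/pwt_gt0|exact: pwt_le1].
have := @wt_sum [seq (e, x) | x <- A]; rewrite big_map map_inj_uniq; last by move=> ? ? [].
by move=> /(_ uA) /=; lra.
Qed.

Variables (x0 : X) (c : seq (edge G)).
Hypothesis c_path : is_path (lab x0) c.
Hypothesis c_run : run c x0 = x0.

Definition cpow n := flatten (nseq n c).

Lemma run_cpow n : run (cpow n) x0 = x0.
Proof. by elim: n => //= n ih; rewrite /cpow /= run_cat c_run. Qed.

Lemma pwt_cpow n : pwt (cpow n) x0 = pwt c x0 ^+ n.
Proof. by elim: n => //= n ih; rewrite /cpow /= pwt_cat c_run exprS -ih. Qed.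

Lemma cpow_path n : is_path (lab x0) (cpow n).
Proof.
elim: n => //= n ih; rewrite /cpow /= is_path_cat c_path /=.
by rewrite -(lab_run lab_act)// c_run.
Qed.

(** The operators T_p T_c^n T_v, divided by the weight of the word v c^n p at x, converge in norm
    to the matrix unit from x to y = p.x0: at x they take the value xi_y for every n, and at
    the other states their size is O(2^-n). *)
Lemma rep_irreducible :
  (forall y, exists2 s, is_path (lab x0) s & run s x0 = y) ->
  (forall x, exists v, [/\ v != [::], is_path (lab x) v, run v x = x0 &
     forall x', x' != x -> lab x' = lab x ->
       forall n, pwt (cpow n) (run v x') <= (pwt c x0 / 2) ^+ n]) ->
  irreducible fsa rep.
Proof.
move=> reach iso; apply: wot_closure_matrix_units.
- exists 0; first exact: fsa0.
  by have := repZ lab act wt_sum 0 0; rewrite !scale0r.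
- move=> _ _ [S fS <-] [T fT <-]; exists (S + T); first exact: fsaD.
  exact: repD.
- move=> a _ [T fT <-]; exists (a *: T); first exact: fsaZ.
  exact: repZ.
move=> x y; have [p p_path p_run] := reach y; have [v [v0 v_path v_run viso]] := iso x.
pose s n := v ++ cpow n ++ p.
have s_path n : is_path (lab x) (s n).
  rewrite /s !is_path_cat v_path -(lab_run lab_act)// v_run cpow_path /=.
  by rewrite -(lab_run lab_act) ?cpow_path// run_cpow.
pose gp n : gpath G := @GPath G (lab x, s n) (s_path n).
pose lam := pwt c x0.
have pwt0 t z : 0 < pwt t z by exact: pwt_gt0.
pose K := (pwt v x * pwt p x0)^-1.
have K0 : 0 < K by rewrite invr_gt0 mulr_gt0.
apply: wot_closure_norm => e e0.
have [n nK] : exists n, K * 2^-1 ^+ n <= complex.Re e.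
  by apply: half_pow_small => //; rewrite -ltcR gt0_Re.
pose a := K * lam ^- n.
have lamp : 0 < lam by exact: pwt0.
have a0 : 0 < a by rewrite mulr_gt0// invr_gt0 exprn_gt0.
exists (a%:C *: rep (L (gp n))).
  exists (a%:C *: L (gp n)); first by apply: fsaZ; exact: fsa_creation.
  exact: repZ.
apply: (@le_trans _ _ (K * 2^-1 ^+ n)%:C); last by rewrite -(gt0_Re e0) lecR.
have Kn0 : 0 < K * 2^-1 ^+ n by rewrite mulr_gt0// exprn_gt0// invr_gt0.
apply: (op_bound_basis (al := fun z => (K * 2^-1 ^+ n * pwt v z)%:C)).
- by rewrite lecR ltW.
- move=> z; rewrite opBE opZE rep_creation_basis rank1E inner_basisl ell2_basisE.
  rewrite -[psrc (gp n)]/(lab x) -[pedges (gp n)]/(s n).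
  have sw z' : pwt (s n) z' = pwt v z' * (pwt (cpow n) (run v z') *
      pwt p (run (cpow n) (run v z'))) by rewrite /s !pwt_cat.
  have [->|zx] := eqVneq z x.
    rewrite eqxx conjC1 scale1r sw v_run pwt_cpow run_cpow.
    rewrite /s !run_cat v_run run_cpow p_run scalerA -rmorphM.
    rewrite (_ : a * _ = 1) ?scale1r ?subrr ?normr0; last first.
      have pn0 : pwt v x * pwt p x0 != 0 by rewrite lt0r_neq0// mulr_gt0.
      have ln0 : lam ^+ n != 0 by rewrite lt0r_neq0// exprn_gt0.
      have -> : pwt v x * (lam ^+ n * pwt p x0) = pwt v x * pwt p x0 * lam ^+ n by ring.
      by rewrite mulrACA (mulVf pn0) (mulVf ln0) mulr1.
    by rewrite lecR mulr_ge0 ?(ltW (pwt0 _ _)) ?(ltW Kn0).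
  rewrite conjC0 scale0r subr0.
  have al0 : 0 <= (K * 2^-1 ^+ n * pwt v z)%:C.
    by rewrite lecR mulr_ge0 ?(ltW (pwt0 _ _)) ?(ltW Kn0).
  have [xz|_] := eqVneq (lab x) (lab z); last by rewrite scaler0 normr0.
  rewrite scalerA normrZ ell2_basis_norm mulr1 -rmorphM.
  rewrite ger0_norm ?lecR; last by rewrite mulr_ge0 ?(ltW (pwt0 _ _)) ?(ltW a0).
  rewrite sw /a -/lam.
  have hn : pwt (cpow n) (run v z) <= (lam / 2) ^+ n by apply: viso.
  have h1 : pwt p (run (cpow n) (run v z)) <= 1 by exact: pwt_le1.
  have lam0 : 0 < lam ^+ n by rewrite exprn_gt0.
  have -> : K * 2^-1 ^+ n * pwt v z = K / lam ^+ n * (pwt v z * ((lam / 2) ^+ n * 1)).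
    by rewrite expr_div_n exprVn; field; rewrite expf_neq0// lt0r_neq0.
  rewrite ler_wpM2l ?(ltW a0)// ler_wpM2l ?(ltW (pwt0 _ _))//.
  by rewrite ler_pM// ltW.
- move=> A; rewrite (eq_bigr (fun z => ((K * 2^-1 ^+ n) ^+ 2 * pwt v z ^+ 2)%:C)); last first.
    by move=> z _; rewrite -rmorphXn exprMn.
  rewrite -rmorph_sum -rmorphXn lecR -mulr_sumr ler_piMr ?sqr_ge0//.
  by apply: pwt_sum_state => //; exact: fset_uniq.
Qed.

End Irreducible.

(** * An action in which states can be told apart *)

Lemma last_occurrence (T : eqType) (e : T) (y y' t t' : seq T) : e \notin t -> e \notin t' ->
  y ++ e :: t = y' ++ e :: t' -> y = y' /\ t = t'.
Proof.
move=> et et'; elim: y y' => [|a y ih] [|a' y'] //= [].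
- by move=> ->.
- by move=> _ tE; move: et; rewrite tE mem_cat mem_head orbT.
- by move=> _ tE; move: et'; rewrite -tE mem_cat mem_head orbT.
- by move=> -> /ih[-> ->].
Qed.

Lemma first_occurrence (T : eqType) (e : T) (s t y t' : seq T) : e \notin s ->
  s ++ e :: t = y ++ e :: t' -> (size s <= size y)%N.
Proof.
elim: s y => //= f s ih y; rewrite inE negb_or => /andP[ef fs].
case: y => [|g y] /= [fE sE]; last exact: ih fs sE.
by rewrite fE eqxx in ef.
Qed.

Section ResetAction.
Context {G : digraph}.
Local Notation V := (vertex G).
Local Notation E := (edge G).
Variables (e1 e2 : E).
Hypothesis e12 : e1 != e2.
Hypothesis src12 : edge_src e1 = edge_src e2.
Local Notation b := (edge_src e2).
Variable h : V -> seq E.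
Hypothesis h_path : forall v, is_path v (h v).
Hypothesis h_end : forall v, path_end v (h v) = b.
Hypothesis h_free : forall v, e2 \notin h v.

Definition base := edge_rng e2.

Definition tail0 := h base.

Definition loop := e1 :: h (edge_rng e1).

Definition tail n := tail0 ++ flatten (nseq n loop).

Lemma loop_free : e2 \notin loop.
Proof. by rewrite inE negb_or h_free eq_sym e12. Qed.

Lemma loopsS n : flatten (nseq n.+1 loop) = loop ++ flatten (nseq n loop).
Proof. by []. Qed.

Lemma loops_free n : e2 \notin flatten (nseq n loop).
Proof. by elim: n => // n ih; rewrite loopsS mem_cat negb_or loop_free. Qed.

Lemma tail_free n : e2 \notin tail n.
Proof. by rewrite mem_cat negb_or h_free loops_free. Qed.

Lemma size_tail n : size (tail n) = (size tail0 + n * size loop)%N.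
Proof.
rewrite size_cat; congr (_ + _)%N; elim: n => // n ih.
by rewrite loopsS size_cat ih mulSn.
Qed.

Lemma size_tail_ge n : (n <= size (tail n))%N.
Proof. by rewrite size_tail /= mulnS; lia. Qed.

Lemma tail_inj m n : tail m = tail n -> m = n.
Proof.
move=> /(congr1 size); rewrite !size_tail => /eqP; rewrite eqn_add2l eqn_pmul2r//.
by move/eqP.
Qed.

Lemma tail_0 : tail 0 = tail0. Proof. by rewrite /tail /= cats0. Qed.

Lemma loop_path : is_path b loop /\ path_end b loop = b.
Proof. by rewrite /= src12 eqxx h_path; split=> //; exact: h_end. Qed.

Lemma tail_path n : is_path base (tail n) /\ path_end base (tail n) = b.
Proof.
have [lp le] := loop_path.
rewrite /tail is_path_cat path_end_cat h_path h_end /=.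
by elim: n => // n [ih1 ih2]; rewrite loopsS is_path_cat path_end_cat lp le.
Qed.

(** The number of loops after the last e2 encodes the part before that e2.  Encodings are
    positive, so that none of them is [tail0]. *)
Definition resets (u : seq E) : bool :=
  `[< u = tail0 \/ exists y : seq E, u = y ++ e2 :: tail (choice.pickle y).+1 >].

Lemma resets_tail0 : resets tail0. Proof. by apply/asboolP; left. Qed.

Lemma resets_code (y : seq E) : resets (y ++ e2 :: tail (choice.pickle y).+1).
Proof. by apply/asboolP; right; exists y. Qed.

Lemma resets_free u : e2 \notin u -> resets u -> u = tail0.
Proof.
move=> fu /asboolP[//|[y uE]].
by move: fu; rewrite uE mem_cat mem_head orbT.
Qed.

Lemma resets_last (y t : seq E) :
  e2 \notin t -> resets (y ++ e2 :: t) -> t = tail (choice.pickle y).+1.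
Proof.
move=> ft /asboolP[uE|[z uE]].
  have := h_free base; rewrite -/tail0 -uE mem_cat mem_head orbT //.
by have [-> ->] := last_occurrence ft (tail_free _) uE.
Qed.

Lemma resets_loop u : resets u -> ~~ resets (u ++ loop).
Proof.
move=> /asboolP[->|[y ->]]; apply/negP.
  have fl : e2 \notin tail0 ++ loop by rewrite mem_cat negb_or h_free loop_free.
  by move=> /(resets_free fl)/(congr1 size); rewrite size_cat /=; lia.
have fl n : e2 \notin tail n ++ loop by rewrite mem_cat negb_or tail_free loop_free.
rewrite -catA cat_cons => /(resets_last (fl _))/(congr1 size).
by rewrite size_cat /=; lia.
Qed.

Definition step (e : E) (u : seq E) := if (e == e2) && resets u then [::] else rcons u e.

Local Notation walk := (run step).

Lemma step_e2 u : step e2 u = if resets u then [::] else rcons u e2.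
Proof. by rewrite /step eqxx. Qed.

Lemma walk_rcons s e u : walk (rcons s e) u = step e (walk s u).
Proof. by rewrite -cats1 run_cat. Qed.

Lemma walk_noreset s u :
  (forall s1 s2, s = s1 ++ e2 :: s2 -> ~~ resets (u ++ s1)) -> walk s u = u ++ s.
Proof.
elim/last_ind: s => [|s e ih] hs; first by rewrite cats0.
rewrite walk_rcons ih => [|s1 s2 sE].
  rewrite /step -rcons_cat; case: eqP => //= ee.
  have /negPf -> // : ~~ resets (u ++ s) by apply: (hs s [::]); rewrite ee cats1.
by apply: (hs s1 (rcons s2 e)); rewrite sE rcons_cat.
Qed.

Lemma walk_free s u : e2 \notin s -> walk s u = u ++ s.
Proof.
move=> fs; apply: walk_noreset => s1 s2 sE.
by move: fs; rewrite sE mem_cat mem_head orbT.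
Qed.

(** Either no reset occurs, or s is cut after the last one. *)
Lemma walk_decomp s u : walk s u = u ++ s \/
  exists s1 s2, [/\ s = s1 ++ s2, walk s1 u = [::] & walk s u = s2].
Proof.
elim/last_ind: s => [|s e ih]; first by left; rewrite cats0.
rewrite walk_rcons; case hr : ((e == e2) && resets (walk s u)).
  right; exists (rcons s e), [::]; rewrite cats0 walk_rcons /step hr.
  by [].
rewrite /step hr; case: ih => [->|[s1 [s2 [-> r1 ->]]]].
  by left; rewrite rcons_cat.
by right; exists s1, (rcons s2 e); rewrite rcons_cat.
Qed.

Lemma step_end e u : path_end base (step e u) = edge_rng e.
Proof.
rewrite /step; case: ifP => [/andP[/eqP -> _]//|_].
by rewrite -cats1 path_end_cat.
Qed.

Definition home := rcons tail0 e2.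

Lemma walk_home : walk home [::] = [::].
Proof. by rewrite walk_rcons walk_free ?h_free//= /step eqxx resets_tail0. Qed.

Lemma home_path : is_path base home.
Proof. by rewrite /home -cats1 is_path_cat h_path h_end /= eqxx. Qed.

Lemma walk_tail0_e2 z : walk tail0 (rcons z e2) = z ++ e2 :: tail0.
Proof. by rewrite walk_free ?h_free// cat_rcons. Qed.

(** Starting from z e2, the state met before the last letter of [home] is z e2 tail0, and tail0
    is not the encoding of any z. *)
Lemma walk_home_e2 z : walk home (rcons z e2) = rcons (z ++ e2 :: tail0) e2.
Proof.
rewrite walk_rcons walk_tail0_e2 step_e2; case: ifP => // /(resets_last (h_free _)).
by rewrite -[h _]/tail0 -tail_0 => /tail_inj.
Qed.

(** At most one of a word and its extension by [loop] is resetting; the extension is used when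
    the state itself would reset too early. *)
Definition sep_loop w := if resets (w ++ h (path_end base w)) then loop else [::].

Definition sep_mid w := h (path_end base w) ++ sep_loop w.

Definition sep_tail w := tail (choice.pickle (w ++ sep_mid w)).+1.

(** From w this word spells first a state y that is not resetting, then e2 and the encoding of y,
    which makes the final e2 a reset. *)
Definition separator w := sep_mid w ++ e2 :: rcons (sep_tail w) e2.

Lemma sep_mid_free w : e2 \notin sep_mid w.
Proof.
rewrite mem_cat negb_or h_free /sep_loop; case: ifP => // _; exact: loop_free.
Qed.

Lemma sep_mid_noreset w : ~~ resets (w ++ sep_mid w).
Proof.
rewrite /sep_mid /sep_loop; case: ifP => [/resets_loop|]; first by rewrite catA.
by rewrite cats0 => ->.
Qed.

Lemma sep_path w : is_path (path_end base w) (separator w).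
Proof.
have [lp le] := loop_path.
have me : is_path (path_end base w) (sep_mid w) && (path_end (path_end base w) (sep_mid w) == b).
  rewrite /sep_mid is_path_cat path_end_cat h_path h_end /sep_loop.
  by case: ifP => _; rewrite ?lp ?le /= ?eqxx.
case/andP: me => mp /eqP me.
have [tp te] := tail_path (choice.pickle (w ++ sep_mid w)).+1.
by rewrite /separator is_path_cat mp me /= eqxx -/base -cats1 is_path_cat tp te /= eqxx.
Qed.

Lemma walk_sep w u : walk (separator w) u =
  let y := u ++ sep_mid w in
  if resets y then rcons (sep_tail w) e2
  else step e2 (y ++ e2 :: sep_tail w).
Proof.
rewrite /separator run_cat (walk_free _ (sep_mid_free w)) /= walk_rcons.
set y := u ++ sep_mid w; rewrite [step e2 y]step_e2.
case: (resets y); rewrite (walk_free _ (tail_free _)); last by rewrite cat_rcons.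
rewrite step_e2; case: ifP => // /(resets_free (tail_free _)).
by rewrite -tail_0 => /tail_inj.
Qed.

Lemma walk_sep_self w : walk (separator w) w = [::].
Proof.
by rewrite walk_sep /= (negPf (sep_mid_noreset w)) step_e2 resets_code.
Qed.

(** From another state u the same word either resets at its first e2, and then spells an
    encoding from the root, or it ends with the encoding of w put behind something else.  In both
    cases the last letter does not reset. *)
Lemma walk_sep_other w u : u != w -> exists z, walk (separator w) u = rcons z e2.
Proof.
move=> uw; rewrite walk_sep /=; case: ifP => _; first by exists (sep_tail w).
exists ((u ++ sep_mid w) ++ e2 :: sep_tail w).
rewrite step_e2; case: ifP => // /(resets_last (tail_free _))/tail_inj[].
move=> /(pcan_inj choice.pickleK) wu; case/eqP: uw.
have := congr1 size wu; rewrite !size_cat => /eqP; rewrite eqn_add2r => /eqP suw.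
by move/eqP: wu; rewrite eqseq_cat// => /andP[/eqP-> _].
Qed.

(** A state y e2 [tail (pickle y).+1] that resets within q has y at least as long as [tail i] and
    pickle y smaller than the size of q.  Only finitely many y satisfy the latter, so that their
    length is bounded and a large i excludes them. *)
Lemma long_loops_noreset (q : seq E) n0 : exists2 i, (n0 <= i)%N &
  forall s1 s2, tail i ++ e2 :: q = s1 ++ e2 :: s2 -> ~~ resets s1.
Proof.
pose sz k := size (odflt [::] (choice.unpickle k : option (seq E))).
pose N := \max_(k <- iota 0 (size q)) sz k.
exists (maxn N n0).+1; first by rewrite ltnW// ltnS leq_maxr.
set i := (maxn N n0).+1 => s1 s2 qE.
have fi : e2 \notin tail i by exact: tail_free.
have iy := first_occurrence fi qE.
have it : (i <= size (tail i))%N by exact: size_tail_ge.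
apply/negP => /asboolP[s1E|[y s1E]].
  have f0 : e2 \notin tail0 by exact: h_free.
  have : (size (tail i) <= size tail0)%N by rewrite -s1E.
  by rewrite size_tail /i mulSn /=; lia.
have := first_occurrence fi (y := y) (t := q) (t' := tail (choice.pickle y).+1 ++ e2 :: s2).
rewrite qE s1E -catA cat_cons => /(_ erefl) ity.
have kq : (choice.pickle y < size q)%N.
  have hT : ((choice.pickle y).+1 <= size (tail (choice.pickle y).+1))%N.
    exact: size_tail_ge.
  have := congr1 size qE; rewrite s1E.
  move: (tail (choice.pickle y).+1) (tail i) hT ity => T T' hT ity.
  rewrite !size_cat /=; move: (choice.pickle y) (size T) (size T') (size y) (size q) hT ity.
  by move=> *; lia.
have : (sz (choice.pickle y) <= N)%N.
  by rewrite /N (big_rem (choice.pickle y)) ?mem_iota//= leq_maxl.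
rewrite /sz choice.pickleK /=; move: it ity; rewrite /i.
by move: (size (tail _)) (size y) => a b; lia.
Qed.

End ResetAction.

(** * Weights *)

Section Weights.
Context {R : realType} {P : countType}.

Lemma geometric_half_sum n : \sum_(k <- iota 0 n) 2^-1 ^+ k.+1 = 1 - 2^-1 ^+ n :> R.
Proof.
elim: n => [|n ih]; first by rewrite big_nil expr0 subrr.
by rewrite -addn1 iotaD big_cat /= ih big_seq1 add0n addn1 exprS; lra.
Qed.

Lemma pickle_half_sum (D : seq P) : uniq D ->
  \sum_(p <- D) 2^-1 ^+ (choice.pickle p).+1 <= 1 :> R.
Proof.
move=> uD; pose n := (\max_(p <- D) choice.pickle p).+1.
apply: (@le_trans _ _ (\sum_(k <- iota 0 n) 2^-1 ^+ k.+1)); last first.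
  by rewrite geometric_half_sum gerBl exprn_ge0// invr_ge0.
rewrite -(big_map (@choice.pickle P) xpredT (fun k => 2^-1 ^+ k.+1)).
apply: sum_le_uniq => [k||k]; first by rewrite exprn_ge0// invr_ge0.
  by rewrite map_inj_uniq//; exact: pcan_inj choice.pickleK.
move=> /mapP[p pD ->]; rewrite mem_iota /= ltnS.
by rewrite (big_rem p)//= leq_maxl.
Qed.

(** With mu = 1 / (2 N) and N = |S| + 1, the elements of S contribute |S| mu^2 to the sum of the
    squares and all the other ones together at most mu^2. *)
Lemma weights_exist (S : seq P) : exists (m : P -> R) (mu : R),
  [/\ 0 < mu, forall p, 0 < m p, forall p, p \in S -> m p = mu,
      forall p, p \notin S -> m p <= mu / 2 &
      forall D, uniq D -> \sum_(p <- D) m p ^+ 2 <= 4^-1].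
Proof.
pose N : R := (size S).+1%:R.
have N0 : 0 < N by rewrite ltr0n.
pose mu := (2 * N)^-1.
have mu0 : 0 < mu by rewrite invr_gt0 mulr_gt0.
pose w (p : P) : R := 2^-1 ^+ (choice.pickle p).+1.
have w0 p : 0 < w p by rewrite exprn_gt0// invr_gt0.
have w1 p : w p <= 2^-1.
  by rewrite /w exprS ler_piMr ?invr_ge0// exprn_ile1 ?invr_ge0// invf_le1// ler1n.
exists (fun p => if p \in S then mu else mu * w p), mu; split => //.
- by move=> p; case: ifP => _ //; rewrite mulr_gt0.
- by move=> p ->.
- by move=> p /negPf ->; rewrite ler_wpM2l// ltW.
move=> D uD.
apply: (@le_trans _ _ (\sum_(p <- D | p \in S) mu ^+ 2 + mu ^+ 2 * \sum_(p <- D) w p)).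
  rewrite (bigID (mem S)) /=; apply: lerD.
    by apply: ler_sum => p ->.
  rewrite mulr_sumr [leRHS](bigID (mem S)) /= -[leLHS]add0r; apply: lerD.
    by rewrite sumr_ge0// => p _; rewrite mulr_ge0 ?sqr_ge0// ltW.
  apply: ler_sum => p /negPf ->; rewrite exprMn ler_wpM2l ?sqr_ge0//.
  rewrite expr2 ler_piMr ?(ltW (w0 p))//; apply: le_trans (w1 p) _.
  by rewrite invf_le1// ler1n.
have sD : \sum_(p <- D | p \in S) mu ^+ 2 <= \sum_(p <- S) mu ^+ 2.
  rewrite -big_filter; apply: sum_le_uniq; [by move=> p; rewrite sqr_ge0|exact: filter_uniq|].
  by move=> p; rewrite mem_filter => /andP[].
have := pickle_half_sum uD; rewrite -/(w _) => hw.
have mu2 : mu ^+ 2 * N <= 4^-1.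
  rewrite /mu exprVn exprMn invfM -mulrA -natrX ler_piMr ?invr_ge0//.
  by rewrite expr2 invfM -mulrA mulVf ?lt0r_neq0// mulr1 invf_le1// ler1n.
apply: le_trans mu2; rewrite /N -natr1 mulrDr mulr1 lerD//.
  by apply: le_trans sD _; rewrite big_const_seq count_predT iter_addr_0 mulr_natr.
by rewrite ler_piMr ?sqr_ge0.
Qed.

End Weights.

(** * Graphs that are strongly transitive *)

Section StateSpace.
Context {R : realType} {G : digraph}.
Local Notation V := (vertex G).
Local Notation E := (edge G).
Variables (e1 e2 : E).
Hypothesis e12 : e1 != e2.
Hypothesis src12 : edge_src e1 = edge_src e2.
Variable h : V -> seq E.
Hypothesis h_path : forall v, is_path v (h v).
Hypothesis h_end : forall v, path_end v (h v) = edge_src e2.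
Hypothesis h_free : forall v, e2 \notin h v.
Local Notation base := (base e2).
Local Notation step := (step e1 e2 h).
Local Notation walk := (run step).
Local Notation home := (home e2 h).
Local Notation tail0 := (tail0 e2 h).

(** The words that are spelled from the root without reset; they are exactly the words that can be
    reached from the root. *)
Definition is_state (u : seq E) := is_path base u && (walk u [::] == u).

Definition state := {u : seq E | is_state u}.

Definition state0 : state := exist _ [::] isT.

(** The default value of [insubd] is used only for edges that do not start at the label of x. *)
Definition act (e : E) (x : state) : state := insubd x (step e (val x)).

Definition lab (x : state) : V := path_end base (val x).

Lemma val_act e x : edge_src e = lab x -> val (act e x) = step e (val x).
Proof.
move=> ex; rewrite val_insubd; suff -> : is_state (step e (val x)) by [].
have /andP[px /eqP rx] := valP x.
case ea : (step e (val x)) => [//|f s]; rewrite -ea.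
have aE : step e (val x) = rcons (val x) e.
  by move: ea; rewrite /step; case: ifP.
by rewrite /is_state aE walk_rcons rx aE eqxx -cats1 is_path_cat px /= ex eqxx.
Qed.

Lemma lab_act e x : edge_src e = lab x -> lab (act e x) = edge_rng e.
Proof. by move=> ex; rewrite /lab val_act// step_end. Qed.

Local Notation runs := (run act).

Lemma val_run s x : is_path (lab x) s -> val (runs s x) = walk s (val x).
Proof.
elim: s x => //= e s ih x /andP[/eqP ex ps].
by rewrite ih ?lab_act// val_act.
Qed.

Lemma runs_state0 (y : state) : is_path (lab state0) (val y) /\ runs (val y) state0 = y.
Proof.
have /andP[py /eqP ry] := valP y; split=> //.
by apply: val_inj; rewrite val_run.
Qed.

Lemma runs_home : runs home state0 = state0.
Proof. by apply: val_inj; rewrite val_run ?walk_home//; exact: home_path. Qed.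

Definition home_prefixes : seq (seq E) := [seq take i home | i <- iota 0 (size home)].

Lemma home_prefixesP u : reflect (exists2 t, home = u ++ t & t != [::]) (u \in home_prefixes).
Proof.
apply: (iffP mapP) => [[j] | [t rE t0]].
  rewrite mem_iota /= => ir ->; exists (drop j home); first by rewrite cat_take_drop.
  by rewrite -size_eq0 size_drop subn_eq0 -ltnNge.
exists (size u); last by rewrite rE take_size_cat.
by rewrite mem_iota /= rE size_cat -[ltnLHS]addn0 ltn_add2l lt0n size_eq0.
Qed.

(** This finite set contains the steps made by [home] from the root; only the size of the states
    in it matters, so all letters of [home] are combined with all prefixes. *)
Definition heavy : seq (E * state) :=
  [seq (e, x) | e <- home, x <- pmap insub home_prefixes].

Lemma heavyP e (x : state) : ((e, x) \in heavy) = (e \in home) && (val x \in home_prefixes).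
Proof.
apply/allpairsP/andP => [[[f y] /= [fr yr [eE xE]]] | [er xr]].
  by rewrite eE xE fr -mem_pmap_sub.
by exists (e, x); rewrite mem_pmap_sub.
Qed.

Lemma heavy_size e x : (e, x) \in heavy -> (size (val x) < size home)%N.
Proof.
rewrite heavyP => /andP[_ /home_prefixesP[t -> t0]].
by rewrite size_cat -[ltnLHS]addn0 ltn_add2l lt0n size_eq0.
Qed.

Lemma heavy_prefix e (x : state) t : e \in home -> home = val x ++ t -> t != [::] ->
  (e, x) \in heavy.
Proof. by move=> er rE t0; rewrite heavyP er; apply/home_prefixesP; exists t. Qed.

Variables (m : E * state -> R) (mu : R).
Hypothesis mu0 : 0 < mu.
Hypothesis m0 : forall p, 0 < m p.
Hypothesis m_heavy : forall p, p \in heavy -> m p = mu.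
Hypothesis m_light : forall p, p \notin heavy -> m p <= mu / 2.
Hypothesis m_sum : forall D, uniq D -> \sum_(p <- D) m p ^+ 2 <= 4^-1.

Definition wt e x : R := m (e, x).

Local Notation pwts := (pwt act wt).

Lemma wt_sum : forall D : seq (E * state), uniq D -> \sum_(d <- D) wt d.1 d.2 ^+ 2 <= 4^-1.
Proof.
move=> D /m_sum; rewrite (eq_bigr (fun d => wt d.1 d.2 ^+ 2))// => -[e x] _.
by [].
Qed.

Lemma wt_gt0 e x : 0 < wt e x. Proof. exact: m0. Qed.

Lemma m_le p : m p <= mu.
Proof.
have [/m_heavy ->//|/m_light pm] := boolP (p \in heavy).
by apply: le_trans pm _; rewrite ler_piMr ?invf_le1 ?ler1n// ltW.
Qed.

Lemma pwts_le_mu s x : pwts s x <= mu ^+ size s.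
Proof.
elim: s x => //= e s ih x; rewrite exprS ler_pM ?(ltW (wt_gt0 _ _))//.
  by apply/ltW/pwt_gt0; exact: wt_gt0.
exact: m_le.
Qed.

Lemma pwt_rcons s e x : pwts (rcons s e) x = pwts s x * wt e (runs s x).
Proof. by rewrite -cats1 pwt_cat /= mulr1. Qed.

Lemma pwts_tail0_prefix s t : tail0 = s ++ t -> pwts s state0 = mu ^+ size s.
Proof.
elim/last_ind: s t => [//|s e ih] t tE.
rewrite pwt_rcons (ih (e :: t)) -?cat_rcons// size_rcons exprSr; congr (_ * _).
apply: m_heavy; have := h_path base; rewrite -/tail0 tE -cats1 !is_path_cat => /andP[/andP[ps _] _].
have vs : val (runs s state0) = s.
  rewrite val_run//= walk_free//; have := h_free base; apply: contra.
  by rewrite -/tail0 tE cat_rcons mem_cat => ->.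
apply: (@heavy_prefix _ _ (e :: rcons t e2)) => //.
  by rewrite /home mem_rcons inE tE mem_cat mem_rcons mem_head /= orbT.
by rewrite vs /home tE cat_rcons rcons_cat.
Qed.

Lemma pwts_home : pwts home state0 = mu ^+ size home.
Proof.
rewrite /home pwt_rcons (@pwts_tail0_prefix _ [::]) ?cats0// size_rcons exprSr.
congr (_ * _); apply: m_heavy; apply: (@heavy_prefix _ _ [:: e2]) => //.
  by rewrite mem_rcons mem_head.
by rewrite val_run ?walk_free ?h_free ?cats1//; exact: h_path.
Qed.

(** The last step of [home] is made from a state longer than all proper prefixes of [home], hence
    with a light weight. *)
Lemma pwts_home_e2 (x : state) z : val x = rcons z e2 ->
  pwts home x <= mu ^+ size home / 2 /\ exists z', val (runs home x) = rcons z' e2.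
Proof.
move=> xE; have lx : lab x = base by rewrite /lab xE -cats1 path_end_cat.
have pt : is_path (lab x) tail0 by rewrite lx; exact: h_path.
split; last first.
  exists (z ++ e2 :: tail0); rewrite val_run ?lx ?xE; last exact: home_path.
  exact: walk_home_e2.
rewrite /home pwt_rcons size_rcons exprSr -mulrA ler_pM ?(ltW (wt_gt0 _ _))//.
- by apply/ltW/pwt_gt0; exact: wt_gt0.
- exact: pwts_le_mu.
- apply: m_light; apply/negP => /heavy_size.
  rewrite val_run// xE walk_tail0_e2// size_cat /= size_rcons; lia.
Qed.

Lemma pwts_cpow_e2 n (x : state) z : val x = rcons z e2 ->
  pwts (cpow home n) x <= (pwts home state0 / 2) ^+ n.
Proof.
rewrite pwts_home; elim: n x z => [|n ih] x z xE; first by rewrite expr0.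
have [le [z' zE]] := pwts_home_e2 xE.
rewrite /cpow /= pwt_cat exprS ler_pM ?(ltW (pwt_gt0 _ _ _ _))//; try exact: wt_gt0.
exact: ih zE.
Qed.

Lemma state_irreducible :
  irreducible (free_semigroupoid_algebra R G) (weighted_rep lab act wt_sum).
Proof.
apply: (@rep_irreducible _ _ _ lab act wt lab_act wt_sum wt_gt0 state0 home).
- exact: home_path.
- exact: runs_home.
- by move=> y; have [py ry] := runs_state0 y; exists (val y).
move=> x; exists (separator e1 e2 h (val x)).
have px : is_path (lab x) (separator e1 e2 h (val x)) by exact: sep_path.
split=> //.
- by rewrite /separator; case: (sep_mid _ _ _ _).
- by apply: val_inj; rewrite val_run// walk_sep_self.
move=> x' xx lx n.
have [z zE] : exists z, walk (separator e1 e2 h (val x)) (val x') = rcons z e2.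
  by apply: walk_sep_other.
by apply: (@pwts_cpow_e2 _ _ z); rewrite val_run ?lx.
Qed.

(** The state u = tail e2 g isolates w0, where g is a path to the source of w0: a word other than w0
    with the same effect on u has the form s u w0 with s leading u to the root, and the factor
    u alone has weight at most 2^-|u|. *)
Lemma state_faithful : transitive_graph G ->
  faithful (free_semigroupoid_algebra R G) (weighted_rep lab act wt_sum).
Proof.
move=> trans; apply: (@rep_faithful _ _ _ lab act wt wt_sum wt_gt0) => w0 eps eps0.
have [g gp ge] : exists2 g, is_path base g & path_end base g = psrc w0.
  have [->|xw] := eqVneq base (psrc w0); first by exists [::].
  have [p [ps pr]] := trans _ _ xw; exists (pedges p); first by rewrite -ps gpathP.
  by rewrite -ps.
have [n0 hn0] := half_pow_small (ltr0n R 2) eps0.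
have [i n0i noreset] := long_loops_noreset e12 h_free (g ++ pedges w0) n0.
pose u0 := tail e1 e2 h i ++ e2 :: g.
have [tp te] := tail_path src12 h_path h_end i.
have u0_state : is_state u0.
  rewrite /is_state /u0 is_path_cat tp te /= eqxx gp /=.
  rewrite walk_noreset// => s1 s2 sE; apply: (noreset s1 (s2 ++ pedges w0)).
  by have := congr1 (cat^~ (pedges w0)) sE; rewrite /= -!catA.
pose u : state := exist _ u0 u0_state.
have lu : lab u = psrc w0 by rewrite /lab /= /u0 path_end_cat te.
exists u; split=> //.
have wp : is_path (lab u) (pedges w0) by rewrite lu gpathP.
have w0_run : val (runs (pedges w0) u) = u0 ++ pedges w0.
  rewrite val_run// walk_noreset// => s1 s2 sE; apply: (noreset _ s2).
  by rewrite /= /u0 sE -!catA.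
pose y := u0 ++ pedges w0.
pose B := pwts u0 state0 * pwts (pedges w0) u.
have [u0p u0r] := runs_state0 u.
have yB : pwts y state0 = B by rewrite /y pwt_cat u0r.
pose cut (s : seq E) := take (size s - size y) s.
move=> D uD hD.
have cutE s : s \in D -> s = cut s ++ y /\ pwts s u = pwts (cut s) u * B.
  move=> sD; have [sp sw sr] := hD s sD.
  have sv : walk s (val u) = y by rewrite -val_run// sr.
  have [sE|[s1 [s2 [sE s1r s2r]]]] := walk_decomp e1 e2 h s (val u).
    move: sv; rewrite sE /y => /eqP; rewrite eqseq_cat// eqxx /= => /eqP wE.
    by rewrite wE eqxx in sw.
  have s2y : s2 = y by rewrite -s2r.
  rewrite s2y in sE; have cs : cut s = s1 by rewrite /cut sE size_cat addnK take_size_cat.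
  rewrite cs; split=> //; rewrite sE pwt_cat -yB; congr (_ * pwts _ _).
  by apply: val_inj; rewrite val_run//; move: sp; rewrite sE is_path_cat => /andP[].
have cut_inj : {in D &, injective cut}.
  move=> s s' sD sD' ss; have [-> _] := cutE s sD; have [-> _] := cutE s' sD'.
  by rewrite ss.
have B0 : 0 < B by rewrite mulr_gt0//; apply: pwt_gt0; exact: wt_gt0.
have c0 : 0 < pwts (pedges w0) u by apply: pwt_gt0; exact: wt_gt0.
have p0 : 0 <= pwts u0 state0 by apply/ltW/pwt_gt0; exact: wt_gt0.
apply: (@le_trans _ _ (\sum_(s <- map cut D) pwts s u ^+ 2 * B ^+ 2)).
  rewrite big_map big_seq [leRHS]big_seq; apply: ler_sum => s sD.
  by have [_ ->] := cutE s sD; rewrite exprMn.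
rewrite -mulr_suml; apply: (@le_trans _ _ (2 ^+ 2 * B ^+ 2)).
  rewrite ler_wpM2r ?sqr_ge0//; apply: (@le_trans _ _ 2).
    by apply: pwt_sum; [exact: wt_sum|rewrite map_inj_in_uniq].
  by rewrite -natrX ler_nat.
rewrite -exprMn ler_sqr ?nnegrE ?mulr_ge0 ?(ltW B0) ?(ltW eps0) ?(ltW c0)//.
rewrite /B mulrA ler_wpM2r ?(ltW c0)//; apply: le_trans hn0.
rewrite ler_wpM2l//; apply: (@le_trans _ _ (2^-1 ^+ size u0)).
  by apply: pwt_le; [exact: wt_sum|exact: wt_gt0].
rewrite ler_wiXn2l ?invr_ge0 ?invf_le1 ?ler1n//.
apply: leq_trans n0i _; rewrite /u0 size_cat.
by apply: leq_trans (leq_addr _ _); exact: size_tail_ge.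
Qed.

Lemma state_rep : transitive_graph G ->
  exists (H : hilbertType R) (rho : bounded_op (ell2 R (gpath G)) -> bounded_op H),
    [/\ representation (free_semigroupoid_algebra R G) rho,
        faithful (free_semigroupoid_algebra R G) rho &
        irreducible (free_semigroupoid_algebra R G) rho].
Proof.
move=> trans; exists (ell2 R state), (weighted_rep lab act wt_sum); split.
- exact: rep_representation lab_act wt_sum.
- exact: state_faithful.
- exact: state_irreducible.
Qed.

End StateSpace.

Section Sufficiency.
Context {R : realType} {G : digraph}.
Local Notation fsa := (free_semigroupoid_algebra R G).

Lemma strongly_transitive_rep (x : vertex G) : strongly_transitive G ->
  exists (H : hilbertType R) (rho : bounded_op (ell2 R (gpath G)) -> bounded_op H),
    [/\ representation fsa rho, faithful fsa rho & irreducible fsa rho].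
Proof.
move=> st; have [e1 [e2 [e12 src12]]] := branching_vertex x st.
have [_ trans _] := st.
have [h hP] := transitive_first_visit (edge_src e2) trans.
have h_path v : is_path v (h v) by have [] := hP v.
have h_end v : path_end v (h v) = edge_src e2 by have [] := hP v.
have h_free v : e2 \notin h v.
  by have [_ _ /allP fh] := hP v; apply/negP => /fh; rewrite eqxx.
have [m [mu [mu0 m0 m_heavy m_light m_sum]]] :=
  @weights_exist R _ (@heavy G e1 e2 h).
exact: (state_rep e12 src12 h_path h_end h_free mu0 m0 m_heavy m_light m_sum trans).
Qed.

(** Without vertices there is no path, and every operator on the zero space is 0. *)
Lemma empty_rep : ~ (exists x : vertex G, True) ->
  exists (H : hilbertType R) (rho : bounded_op (ell2 R (gpath G)) -> bounded_op H),
    [/\ representation fsa rho, faithful fsa rho & irreducible fsa rho].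
Proof.
move=> noV; have op_eq (S T : bounded_op (ell2 R (gpath G))) : S = T.
  apply: op_ext_basis => w; case: noV; exists (psrc w).
  by [].
exists (ell2 R (gpath G)), id; split.
- by split=> //; apply: continuous_subspaceT => A; exact: cvg_id.
- by move=> S T _ _ _; exact: op_eq.
- apply/seteqP; split=> // T _; apply: subset_wot_closure; exists 0; first exact: fsa0.
  exact: op_eq.
Qed.

End Sufficiency.

Theorem theorem5p6 (R : realType) (G : digraph) (hG : ~ trivial_graph G) :
  (exists (H : hilbertType R)
      (rho : bounded_op (ell2 R (gpath G)) -> bounded_op H),
    [/\ representation (free_semigroupoid_algebra R G) rho,
        faithful (free_semigroupoid_algebra R G) rho &
        irreducible (free_semigroupoid_algebra R G) rho])
  <-> strongly_transitive G.
Proof.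
split=> [[H [rho [rep inj irr]]]|st].
  split=> //; first exact: rep_transitive rep inj irr.
  move=> /cycle_graph_cycle[x [c [sc rc cx comm]]].
  exact: (rep_no_commuting_cycle rep inj irr sc rc cx comm).
have [[x _]|noV] := pselect (exists x : vertex G, True).
  exact: strongly_transitive_rep st.
exact: empty_rep.
Qed.
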